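(* $\mathrm{SCM}(7,2;3;*,2,3)=\mathrm{RE}$. That is, a language is recursively enumerable if and only if it is generated by an SCM grammar with all of the following properties: - degree $(7,2)$; - at most $3$ nonterminals; - an arbitrary finite number of conditional matrices; - all matrices of length at most $2$; - at most $3$ non-simple matrices.
   Context: A semi-conditional matrix (SCM) grammar is a quadruple $G=(V,T,M,S)$ with the following components. - $V$ is a finite alphabet and $T\subsetneq V$ is the set of terminals. - $N=V\setminus T$ is the set of nonterminals and $S\in N$ is the start symbol. - $M$ is a finite set of matrices of the form $r=[(A_1\to x_1),\dots,(A_\ell\to x_\ell),P,F]$, where $\ell\ge 1$, $A_k\in N$, $x_k\in V^*$, and $P,F\in V^+\cup\{\emptyset\}$. Here $\emptyset\notin V$ is a special symbol meaning that the condition is absent, and $|\emptyset|=0$. The number $\ell$ is the length of $r$. A matrix is classified as follows: - unconditional if $P=F=\emptyset$, and conditional otherwise; - simple if at least one of $P,F$ equals $\emptyset$, and non-simple if both $P\neq\emptyset$ and $F\neq\emptyset$. For $x,y\in V^*$ we write $x\Rightarrow_r y$ iff all of the following hold: 1. if $P\neq\emptyset$ then $P$ is a subword (factor) of $x$; 2. if $F\neq\emptyset$ then $F$ is not a subword of $x$; 3. there are words $x=y_0,y_1,\dots,y_\ell=y$ such that $y_k$ is obtained from $y_{k-1}$ by replacing one occurrence of $A_k$ by $x_k$. $\Rightarrow_G$ is the union of the relations $\Rightarrow_r$ over $r\in M$, and $L(G)=\{y\in T^*: S\Rightarrow_G^* y\}$. $G$ has degree $(i,j)$ if every matrix satisfies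 $|P|\le i$ and $|F|\le j$. $\mathrm{SCM}(i,j;n;m,\ell,s)$ denotes the family of languages $L(G)$ of SCM grammars $G$ that satisfy all of the following: - $G$ has degree $(i,j)$; - $|N|\le n$; - $G$ has at most $m$ conditional matrices; - every matrix of $G$ has length at most $\ell$; - $G$ has at most $s$ non-simple matrices. A $*$ in a parameter position means that parameter is unbounded. $\mathrm{SSCM}(i,j;n;m,\ell)=\mathrm{SCM}(i,j;n;m,\ell,0)$, i.e., all matrices are simple. $\mathrm{RE}$ is the class of recursively enumerable languages. *)

(* Defs.v *)
From mathcomp Require Import all_boot.
Set Implicit Arguments.
Unset Strict Implicit.
Unset Printing Implicit Defensive.

(* Symbols of a grammar with terminal alphabet T and nonterminals N:
   V = T + N  (inl = terminal, inr = nonterminal). *)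

Inductive rtc (A : Type) (R : A -> A -> Prop) : A -> A -> Prop :=
| rtc_refl x : rtc R x x
| rtc_step x y z : R x y -> rtc R y z -> rtc R x z.

Fixpoint In_seq (A : Type) (a : A) (s : seq A) : Prop :=
  if s is b :: s' then b = a \/ In_seq a s' else False.

Definition is_factor (A : Type) (p x : seq A) : Prop :=
  exists u w, x = u ++ p ++ w.

(* A matrix [(A_1 -> x_1), ..., (A_l -> x_l), P, F];
   None plays the role of the special symbol "empty condition". *)
Record scm_matrix (T N : Type) := SCMMatrix {
  mx_rules : seq (N * seq (T + N));
  mx_P : option (seq (T + N));
  mx_F : option (seq (T + N)) }.

Record scm_grammar (T : Type) := SCMGrammar {
  scm_N : finType;
  scm_S : scm_N;
  scm_M : seq (scm_matrix T scm_N) }.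

Definition cond_size (A : Type) (o : option (seq A)) : nat :=
  if o is Some p then size p else 0.

Definition cond_nonempty (A : Type) (o : option (seq A)) : bool :=
  if o is Some p then 0 < size p else true.

Definition matrix_wf (T N : Type) (r : scm_matrix T N) : bool :=
  [&& 0 < size (mx_rules r), cond_nonempty (mx_P r) & cond_nonempty (mx_F r)].

Definition conditional (T N : Type) (r : scm_matrix T N) : bool :=
  isSome (mx_P r) || isSome (mx_F r).

Definition non_simple (T N : Type) (r : scm_matrix T N) : bool :=
  isSome (mx_P r) && isSome (mx_F r).

Inductive apply_rules (T N : Type) :
  seq (N * seq (T + N)) -> seq (T + N) -> seq (T + N) -> Prop :=
| ar_nil x : apply_rules [::] x x
| ar_cons (A : N) (xA : seq (T + N)) rs u w y :
    apply_rules rs (u ++ xA ++ w) y ->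
    apply_rules ((A, xA) :: rs) (u ++ inr A :: w) y.

Definition matrix_step (T N : Type) (r : scm_matrix T N) (x y : seq (T + N)) : Prop :=
  (if mx_P r is Some P then is_factor P x else True) /\
  (if mx_F r is Some F then ~ is_factor F x else True) /\
  apply_rules (mx_rules r) x y.

Definition scm_step (T : Type) (G : scm_grammar T) (x y : seq (T + scm_N G)) : Prop :=
  exists r, In_seq r (scm_M G) /\ matrix_step r x y.

Definition scm_lang (T : Type) (G : scm_grammar T) (w : seq T) : Prop :=
  rtc (@scm_step T G) [:: inr (scm_S G)] (map inl w).

(* an optional upper bound; None = "*" (unbounded) *)
Definition bound (o : option nat) (k : nat) : Prop :=
  if o is Some b then k <= b else True.

Definition scm_params (T : Type) (G : scm_grammar T) (i j : nat)
  (n m l s : option nat) : Prop :=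
  (forall r, In_seq r (scm_M G) ->
     [/\ matrix_wf r, cond_size (mx_P r) <= i, cond_size (mx_F r) <= j
       & bound l (size (mx_rules r))]) /\
  bound n #|scm_N G| /\
  bound m (count (@conditional T (scm_N G)) (scm_M G)) /\
  bound s (count (@non_simple T (scm_N G)) (scm_M G)).

Definition SCM (T : Type) (i j : nat) (n m l s : option nat) (L : seq T -> Prop) : Prop :=
  exists G : scm_grammar T, scm_params G i j n m l s /\
    forall w, L w <-> scm_lang G w.

Record ps_grammar (T : Type) := PSGrammar {
  ps_N : finType;
  ps_S : ps_N;
  ps_R : seq (seq (T + ps_N) * seq (T + ps_N)) }.

Definition is_nonterminal (T N : Type) (a : T + N) : bool :=
  if a is inr _ then true else false.

Definition ps_wf (T : Type) (G : ps_grammar T) : Prop :=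
  forall uv, In_seq uv (ps_R G) -> has (@is_nonterminal T (ps_N G)) uv.1.

Definition ps_step (T : Type) (G : ps_grammar T) (x y : seq (T + ps_N G)) : Prop :=
  exists u v p q, In_seq (u, v) (ps_R G) /\ x = p ++ u ++ q /\ y = p ++ v ++ q.

Definition ps_lang (T : Type) (G : ps_grammar T) (w : seq T) : Prop :=
  rtc (@ps_step T G) [:: inr (ps_S G)] (map inl w).

Definition RE (T : Type) (L : seq T -> Prop) : Prop :=
  exists G : ps_grammar T, ps_wf G /\ forall w, L w <-> ps_lang G w.

(* Main.v *)
Require Import Defs.
From mathcomp Require Import all_boot zify.

(* From a phrase-structure grammar, a derivation S = x_n => ... => x_1 = w is turned into a
   tiling whose bottom row is x_1 # ... # x_n # and whose top row is w # followed by the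
   bottom row; the rows are thus shifted by one sentential form, and a tile carries either
   a copied symbol or a production. After coding symbols by bits, an SCM grammar writes
   the top row to the left of two markers S AA S and the reversed # (bottom row) to their
   right, bit c being the block A B^i on the left and B^j A on the right with i + j = 3
   exactly when the bits agree. The blocks nearest to the centre are then erased on both
   sides: two letters A, and afterwards single letters B, are rewritten to S at arbitrary
   places, but every later matrix demands the two S to be adjacent, or to enclose AA, or
   all letters A to be gone, so a wrong guess blocks the derivation.

   Conversely, a phrase-structure grammar runs the matrices with a control symbol that
   moves over the sentential form and certifies the absence of a factor by one complete
   left-to-right scan. *)

Set Implicit Arguments.
Unset Strict Implicit.
Unset Printing Implicit Defensive.

(** * List membership and reflexive-transitive closures *)

Lemma In_seqP (A : eqType) (a : A) (s : seq A) : In_seq a s <-> a \in s.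
Proof.
elim: s => //= b s IH; rewrite inE; split.
  by case=> [->|/(proj1 IH) ->]; rewrite ?eqxx ?orbT.
by case/orP=> [/eqP ->|/(proj2 IH)]; [left | right].
Qed.

Lemma In_seq_cat (A : Type) (a : A) (s1 s2 : seq A) :
  In_seq a (s1 ++ s2) <-> In_seq a s1 \/ In_seq a s2.
Proof. by elim: s1 => /= [|b s1 IH]; tauto. Qed.

Lemma In_seq_map (A : eqType) (B : Type) (f : A -> B) (y : B) (s : seq A) :
  In_seq y (map f s) <-> exists2 x, x \in s & y = f x.
Proof.
elim: s => /= [|a s IH]; first by split=> // -[].
split.
  case=> [<-|/(proj1 IH)[x xs ->]]; first by exists a; rewrite ?mem_head.
  by exists x; rewrite // inE xs orbT.
case=> x; rewrite inE => /orP[/eqP-> ->|xs fx]; first by left.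
by right; apply: (proj2 IH); exists x.
Qed.

Lemma In_seq_tnth (A : Type) (a : A) (s : seq A) :
  In_seq a s <-> exists i, a = tnth (in_tuple s) i.
Proof.
split=> [|[i ->]]; last first.
  rewrite (tnth_nth (tnth (in_tuple s) i)) /=; move: (tnth _ i) => a0.
  case: i => i /=; elim: s i => //= b s IH [|i] lt_i; [by left | right; exact: IH].
move=> inA; suff [i lt_i aE] : exists2 i, i < size s & a = nth a s i.
  by exists (Ordinal lt_i); rewrite (tnth_nth a).
elim: s inA => //= b s IH [->|/IH[i lt_i ai]]; first by exists 0.
by exists i.+1.
Qed.

Lemma rtc_mono (A : Type) (R1 R2 : A -> A -> Prop) :
  (forall x y, R1 x y -> R2 x y) -> forall x y, rtc R1 x y -> rtc R2 x y.
Proof.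
move=> R12 x y; elim=> [{}x|{}x y' {}y /R12 xy' _]; first exact: rtc_refl.
exact: rtc_step.
Qed.

Section ReflexiveTransitiveClosure.
Variables (A : Type) (R : A -> A -> Prop).

Lemma rtc_trans x y z : rtc R x y -> rtc R y z -> rtc R x z.
Proof. by elim=> // {}x y' {}y Rxy _ IH /IH; apply: rtc_step. Qed.

Lemma rtc_one x y : R x y -> rtc R x y.
Proof. by move=> Rxy; apply: rtc_step Rxy _; apply: rtc_refl. Qed.

Lemma rtc_snoc x y z : rtc R x y -> R y z -> rtc R x z.
Proof. by move=> Rxy /rtc_one; apply: rtc_trans. Qed.

Lemma rtc_invariant (I : A -> Prop) :
  (forall x y, I x -> R x y -> I y) -> forall x y, rtc R x y -> I x -> I y.
Proof. by move=> IR x y; elim=> // {}x y' {}y Rxy _ IH Ix; apply/IH/IR/Rxy. Qed.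

End ReflexiveTransitiveClosure.

(** * Unique decompositions of a word at marked letters *)

Section Splitting.
Variable A : eqType.
Implicit Types (x y : A) (p q r s : seq A).

Lemma first_split x p q p' q' : x \notin p -> x \notin p' ->
  p ++ x :: q = p' ++ x :: q' -> p = p' /\ q = q'.
Proof.
elim: p p' => [|a p IH] [|a' p'] //=.
- by move=> _ _ [].
- by rewrite inE negb_or => _ /andP[/eqP xa' _] [].
- by rewrite inE negb_or => /andP[/eqP xa _] _ [xa']; case: xa.
rewrite !inE !negb_or => /andP[_ xp] /andP[_ xp'] [-> /(IH _ xp xp')[-> ->]] //.
Qed.

Lemma last_split x p q p' q' : x \notin q -> x \notin q' ->
  p ++ x :: q = p' ++ x :: q' -> p = p' /\ q = q'.
Proof.
move=> xq xq' /(congr1 rev); rewrite !rev_cat !rev_cons !cat_rcons.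
case/first_split; rewrite ?mem_rev //.
by move=> /(congr1 rev) eq_q /(congr1 rev); rewrite !revK in eq_q *.
Qed.

Lemma split_before x p q r t : x \notin r ->
  p ++ x :: q = r ++ t -> exists2 p', p = r ++ p' & t = p' ++ x :: q.
Proof.
elim: r p => [|a r IH] p /=; first by exists p.
rewrite inE negb_or => /andP[/eqP xa xr].
case: p => [[/xa//]|b p [-> /(IH _ xr)[p' -> ->]]].
by exists p'.
Qed.

Lemma cross_split x y p q p' q' : x != y ->
  p ++ x :: q = p' ++ y :: q' ->
  (exists2 r, p = p' ++ y :: r & q' = r ++ x :: q) \/
  (exists2 r, p' = p ++ x :: r & q = r ++ y :: q').
Proof.
move=> /eqP xy; elim: p p' => [|a p IH] [|a' p'] //=.
- by case=> /xy.
- by case=> <- ->; right; exists p'.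
- by case=> -> <-; left; exists p.
by case=> -> /IH[] [r -> ->]; [left | right]; exists r.
Qed.

(** The left side has exactly two occurrences of [x], so counting leaves none for [p'] and [m']. *)
Lemma double_split x p m q p' m' q' :
    x \notin p -> x \notin m -> x \notin q ->
  p ++ x :: m ++ x :: q = p' ++ x :: m' ++ x :: q' ->
  [/\ p = p', m = m' & q = q'].
Proof.
move=> xp xm xq E.
have [xp' xm'] : x \notin p' /\ x \notin m'.
  have := congr1 (count_mem x) E.
  rewrite !count_cat /= !count_cat /= eqxx.
  rewrite (count_memPn xp) (count_memPn xm) (count_memPn xq) => C.
  by split; apply/count_memPn; lia.
have [-> E'] := first_split xp xp' E.
by have [-> ->] := first_split xm xm' E'.
Qed.

End Splitting.

(** * Derivations as tilings *)

Lemma ps_context (T : Type) (G : ps_grammar T) p q x y :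
  rtc (@ps_step T G) x y -> rtc (@ps_step T G) (p ++ x ++ q) (p ++ y ++ q).
Proof.
elim=> [{}x|{}x y' z [u [v [p' [q' [Ruv [-> ->]]]]]] _ IH]; first exact: rtc_refl.
apply: rtc_step IH; exists u, v, (p ++ p'), (q' ++ q).
by rewrite !catA; split.
Qed.

Section Tiles.
Variables (T : finType) (G : ps_grammar T).
Local Notation V := (T + ps_N G)%type.
Local Notation derives := (rtc (@ps_step T G)).
Local Notation tile := (seq (option V + T) * seq (option V))%type.

(* [None] separates consecutive sentential forms; in a tile (top, bottom), top is
   a piece of a sentential form and bottom a piece of its predecessor. *)
Definition tiles : seq tile :=
  [seq ([:: inr a], [:: Some (inl a)]) | a <- enum T] ++
  [seq ([:: inl (Some c)], [:: Some c]) | c <- enum {: V}] ++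
  [seq (map (inl \o Some) uv.2, map Some uv.1) | uv <- ps_R G] ++
  [:: ([:: inl None], [:: None]);
      ([:: inl None; inl (Some (inr (ps_S G))); inl None], [:: None])].

Definition tops (A B : Type) (ps : seq (seq A * seq B)) := flatten (unzip1 ps).
Definition bots (A B : Type) (ps : seq (seq A * seq B)) := flatten (unzip2 ps).

Definition letter (x : option V + T) : option V :=
  match x with inl o => o | inr a => Some (inl a) end.

Lemma pmap_Some (A : Type) (s : seq A) : pmap id (map Some s) = s.
Proof. by elim: s => //= a s ->. Qed.

Lemma pmap_letter_inl (s : seq (option V)) : pmap letter (map inl s) = pmap id s.
Proof. by elim: s => //= a s ->. Qed.

Lemma tileP t : t \in tiles ->
  [\/ [/\ inl None \notin t.1, None \notin t.2 &
          derives (pmap id t.2) (pmap letter t.1)],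
      t = ([:: inl None], [:: None])
    | t = ([:: inl None; inl (Some (inr (ps_S G))); inl None], [:: None])].
Proof.
rewrite !mem_cat => /or4P[/mapP[a _ ->]|/mapP[c _ ->]|/mapP[[u v] uvR ->]|].
- by constructor 1; split=> //=; apply: rtc_refl.
- by constructor 1; split=> //=; apply: rtc_refl.
- constructor 1; split=> /=.
  + by apply/negP => /mapP[].
  + by apply/negP => /mapP[].
  rewrite map_comp pmap_letter_inl !pmap_Some; apply: rtc_one.
  exists u, v, [::], [::]; rewrite !cats0; split=> //.
  by apply/In_seqP.
by rewrite !inE => /orP[/eqP->|/eqP->]; [constructor 2 | constructor 3].
Qed.

(** Induction along the tiling: [top] is the part of the current sentential form not yet tiled,
    [beta] the part of its predecessor read so far. A tile without separator trades a piece of [top]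
    for a piece of [beta] that derives it. *)
Lemma tiling_derives ps top beta : {subset ps <= tiles} ->
    inl None \notin top -> None \notin beta ->
    top ++ inl None :: map inl (beta ++ bots ps) = tops ps ->
  derives [:: inr (ps_S G)] (pmap id beta ++ pmap letter top).
Proof.
elim: ps top beta => [|t ps IH] top beta sub top0 beta0 /=; first by case: top {top0}.
have tt : t \in tiles by apply: sub; rewrite mem_head.
have {}sub : {subset ps <= tiles} by move=> x xs; apply: sub; rewrite inE xs orbT.
have top_nil r r' : top ++ inl None :: r = inl None :: r' -> top = [::] /\ r = r'.
  by move/(@first_split _ _ _ _ [::] _ top0) => []//.
case: (tileP tt) => [[t10 t20 dt]|->|->]; rewrite /tops /bots /=.
- move/(split_before t10) => [top' def_top /esym].
  move: top0; rewrite def_top mem_cat negb_or => /andP[_ top'0].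
  rewrite catA; move/(IH _ _ sub top'0).
  rewrite mem_cat negb_or beta0 t20 => /(_ isT) d.
  apply: rtc_trans d _; rewrite !pmap_cat -catA.
  exact: ps_context.
(* The row is finished: [beta] becomes the form to be tiled, and its own predecessor starts
   empty. *)
- move/top_nil => [-> E].
  move: (IH (map inl beta) [::] sub); rewrite pmap_letter_inl /= cats0; apply=> //.
    by apply/negP => /mapP[x xb [/esym x0]]; move: beta0; rewrite -x0 xb.
  by rewrite /tops -E map_cat.
(* The closing tile forces the last predecessor to be the start symbol. *)
- move/top_nil => [-> E].
  move: E; rewrite map_cat /= -[_ :: _ :: _]/([:: inl _] ++ inl None :: _).
  case/first_split => //.
    by apply/negP => /mapP[x xb [/esym x0]]; move: beta0; rewrite -x0 xb.
  case: beta {beta0} => [|x [|? ?]] //= [->] _.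
  exact: rtc_refl.
Qed.

Definition tileable (top : seq (option V + T)) : Prop :=
  exists2 ps, {subset ps <= tiles} &
    top ++ inl None :: map inl (bots ps) = tops ps.

(** A separator tile joins [row] to a tiling of its bottom: the tops then read [tops row],
    separator, [bots row], separator, [bots ps], which is [tops row], a separator and the joint
    bottom. *)
Lemma tileable_next (row : seq tile) : {subset row <= tiles} ->
  tileable (map inl (bots row)) -> tileable (tops row).
Proof.
move=> sub_row [ps sub_ps E].
exists (row ++ ([:: inl None], [:: None]) :: ps).
  move=> x; rewrite mem_cat inE => /or3P[/sub_row|/eqP->|/sub_ps] //.
  by rewrite !mem_cat !inE eqxx !orbT.
move: E; rewrite /tops /bots /unzip1 /unzip2 !map_cat !flatten_cat map_cat /= => <-.
by [].
Qed.

Lemma copy_tiles (x : seq V) : exists row,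
  [/\ {subset row <= tiles}, bots row = map Some x & tops row = map (inl \o Some) x].
Proof.
exists [seq ([:: inl (Some c)], [:: Some c]) | c <- x]; split.
- move=> t /mapP[c _ ->]; rewrite !mem_cat; apply/or4P; apply: Or42.
  by apply: map_f; rewrite mem_enum.
- by elim: x => //= c x; rewrite /bots /= => ->.
- by elim: x => //= c x; rewrite /tops /= => ->.
Qed.

Lemma derives_tileable x : derives [:: inr (ps_S G)] x ->
  tileable (map (inl \o Some) x).
Proof.
have tops_cat (r1 r2 : seq tile) : tops (r1 ++ r2) = tops r1 ++ tops r2.
  by rewrite /tops /unzip1 map_cat flatten_cat.
have bots_cat (r1 r2 : seq tile) : bots (r1 ++ r2) = bots r1 ++ bots r2.
  by rewrite /bots /unzip2 map_cat flatten_cat.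
move=> d; apply: (rtc_invariant (I := fun x => tileable (map (inl \o Some) x)) _ d).
  move=> {d}y z ty [u [v [p [q [Ruv [yE ->]]]]]]; move: ty; rewrite {}yE.
  have [rp [sp bp tp]] := copy_tiles p; have [rq [sq bq tq]] := copy_tiles q.
  pose row := rp ++ (map (inl \o Some) v, map Some u) :: rq.
  have -> : map (inl \o Some) (p ++ v ++ q) = tops row.
    by rewrite tops_cat tp [tops (_ :: _)]/= -/(tops rq) !map_cat; congr (_ ++ (_ ++ _)).
  have -> : map (inl \o Some) (p ++ u ++ q) = map inl (bots row) :> seq (_ + T).
    rewrite bots_cat bp; have -> : bots ((map (inl \o Some) v, map Some u) :: rq)
      = map Some u ++ bots rq by [].
    by rewrite bq -!map_cat -map_comp.
  apply: tileable_next => t; rewrite mem_cat inE => /or3P[/sp|/eqP->|/sq] //.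
  rewrite !mem_cat; apply/or4P; apply: Or43; apply/mapP.
  by exists (u, v) => //; apply/In_seqP.
(* With # for the separator, these two tiles have joint top S # S # and joint bottom S #. *)
exists [:: ([:: inl (Some (inr (ps_S G)))], [:: Some (inr (ps_S G))]);
        ([:: inl None; inl (Some (inr (ps_S G))); inl None], [:: None])] => //.
move=> t; rewrite !inE => /orP[]/eqP->; rewrite !mem_cat; apply/or4P.
  by apply: Or42; apply: (map_f (fun c => ([:: inl (Some c)], [:: Some c]))); rewrite mem_enum.
by apply: Or44; rewrite !inE eqxx orbT.
Qed.

Lemma ps_lang_tileable w : ps_lang G w <-> tileable (map inr w).
Proof.
split.
  move/derives_tileable => tw.
  pose row : seq tile := [seq ([:: inr a], [:: Some (inl a)]) | a <- w].
  have -> : map inr w = tops row by rewrite /row; elim: w {tw row} => //= a w ->.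
  apply: tileable_next.
    move=> t /mapP[a _ ->]; rewrite !mem_cat; apply/or4P; apply: Or41.
    by apply: map_f; rewrite mem_enum.
  by move: tw; rewrite /row -map_comp; congr tileable; elim: w {row} => //= a w ->.
case=> ps sub E.
have:= @tiling_derives ps (map inr w) [::] sub _ isT E.
have -> : pmap letter (map inr w) = map inl w by elim: w {E} => //= a w ->.
by apply; apply/negP => /mapP[].
Qed.

(** * Coding tiles by bits *)

Definition code (g : option V) : seq bool := rcons (nseq (enum_rank g) true) false.

(** The letters of the generated word stay uncoded, because the SCM grammar emits them as
    terminals. *)
Definition encode (s : seq (option V + T)) : seq (bool + T) :=
  flatten [seq match x with inl g => map inl (code g) | inr a => [:: inr a] end | x <- s].

Definition codes (s : seq (option V)) : seq bool := flatten (map code s).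

Lemma encode_inl s : encode (map inl s) = map inl (codes s).
Proof. by elim: s => //= g s IH; rewrite /encode /codes /= map_cat -IH. Qed.

Lemma encode_cat s1 s2 : encode (s1 ++ s2) = encode s1 ++ encode s2.
Proof. by rewrite /encode map_cat flatten_cat. Qed.

Lemma encode_inr w : encode (map inr w) = map inr w.
Proof. by rewrite /encode; elim: w => //= a w ->. Qed.

(** [code] is a prefix code: the number of [true] before the first [false] is the rank of the
    symbol, and an uncoded terminal cannot be mistaken for a bit. *)
Lemma encode_inj : injective encode.
Proof.
have codeE g s : map inl (code g) ++ s =
    nseq (enum_rank g) (inl true) ++ inl false :: s :> seq (bool + T).
  by rewrite map_rcons map_nseq cat_rcons.
have nofalse n : inl false \notin nseq n (inl true : bool + T).
  by apply/negP => /nseqP[].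
elim=> [|x s IH] [|x' s'] //.
- by case: x' => [g|a] //; rewrite /encode /= codeE; case: (nseq _ _).
- by case: x => [g|a] //; rewrite /encode /= codeE; case: (nseq _ _).
case: x x' => [g|a] [g'|a']; rewrite /encode /= ?codeE.
- case/(first_split (nofalse _) (nofalse _)) => /(congr1 size).
  by rewrite !size_nseq => /ord_inj/enum_rank_inj -> /IH ->.
- by case: (enum_rank g : nat).
- by case: (enum_rank g' : nat).
by case=> -> /IH ->.
Qed.

Definition coded_tiles : seq (seq (bool + T) * seq bool) :=
  [seq (encode t.1, codes t.2) | t <- tiles].

(* [init] codes the separator between the generated word and the bottom row. *)
Definition tiling_lang (tl : seq (seq (bool + T) * seq bool)) (init : seq bool)
    (w : seq T) : Prop :=
  exists2 ps, {subset ps <= tl} & tops ps = map inr w ++ map inl (init ++ bots ps).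

Lemma ps_lang_tiling w : ps_lang G w <-> tiling_lang coded_tiles (code None) w.
Proof.
rewrite ps_lang_tileable.
have topsE (ps : seq tile) :
    tops [seq (encode t.1, codes t.2) | t <- ps] = encode (tops ps).
  by elim: ps => //= t ps; rewrite /tops /= encode_cat => ->.
have botsE (ps : seq tile) :
    bots [seq (encode t.1, codes t.2) | t <- ps] = codes (bots ps).
  by elim: ps => //= t ps; rewrite /bots /codes /= map_cat flatten_cat => ->.
have eqE (ps : seq tile) : map inr w ++ inl None :: map inl (bots ps) = tops ps <->
    encode (tops ps) = map inr w ++ map inl (code None ++ codes (bots ps)).
  rewrite -[code None ++ _]/(codes (None :: bots ps)) -encode_inl -encode_inr.
  by rewrite -encode_cat; split=> [<-|/encode_inj] //.
split=> [[ps sub /eqE E]|[cps sub]].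
  exists [seq (encode t.1, codes t.2) | t <- ps]; last by rewrite topsE botsE.
  by move=> _ /mapP[t /sub tt ->]; apply: map_f.
(* A list of coded tiles is pulled back tile by tile, choosing a preimage for each. *)
have [ps sub_ps ->] : exists2 ps, {subset ps <= tiles} &
    cps = [seq (encode t.1, codes t.2) | t <- ps].
  elim: cps sub => [|c cps IH] sub; first by exists [::].
  have [|ps sub_ps ->] := IH; first by move=> x xs; apply: sub; rewrite inE xs orbT.
  have /mapP[t tt ->] := sub c (mem_head _ _).
  by exists (t :: ps) => // x; rewrite inE => /orP[/eqP->|/sub_ps].
by rewrite topsE botsE => /eqE E; exists ps.
Qed.

End Tiles.

(** * An SCM grammar for tilings *)

Section Grammar.
Variables (T : finType) (tl : seq (seq (bool + T) * seq bool)) (init : seq bool).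
Local Notation V := (T + option bool)%type.
Local Notation S := (inr None : V).
Local Notation A := (inr (Some true) : V).
Local Notation B := (inr (Some false) : V).
Local Notation lang := (tiling_lang tl init).

Definition run (n : nat) : seq V := nseq n B.
Definition lrun (c : bool) : nat := if c then 2 else 1.
Definition rrun (c : bool) : nat := if c then 1 else 2.

Definition left_block (x : bool + T) : seq V :=
  match x with inl c => A :: run (lrun c) | inr a => [:: inl a] end.
Definition left_word (X : seq (bool + T)) : seq V := flatten (map left_block X).
Definition right_word (Y : seq bool) : seq V :=
  flatten [seq run (rrun c) ++ [:: A] | c <- Y].

(** The middle [m] between the two markers governs which matrices apply. *)
Definition marked (p m q : seq V) : seq V := p ++ S :: m ++ S :: q.

(** [B] doubles as the start symbol. Forbidding [A] keeps this matrix from acting on the runs of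
    blocks, since every block contains an [A]. *)
Definition start_matrix : scm_matrix T (option bool) :=
  SCMMatrix [:: (Some false, marked [::] [:: A; A] (right_word (rev init)))]
    None (Some [:: A]).
(** A tile enters next to the centre on both sides, so the tops grow rightwards and the reversed
    bottom grows leftwards. *)
Definition push_matrix (t : seq (bool + T) * seq bool) : scm_matrix T (option bool) :=
  SCMMatrix [:: (None, left_word t.1 ++ [:: S]); (None, S :: right_word (rev t.2))]
    (Some [:: S; A; A; S]) None.
Definition stop_matrix : scm_matrix T (option bool) :=
  SCMMatrix [:: (None, [::]); (None, [::])] (Some [:: S; A; A; S]) None.
Definition mark_matrix : scm_matrix T (option bool) :=
  SCMMatrix [:: (Some true, [:: S]); (Some true, [:: S])] None (Some [:: S]).
(** One marker disappears while some [B] becomes a marker. The two stay adjacent only if that [B]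
    was next to them, in which case it is in effect deleted. *)
Definition eat_matrix (ij : nat * nat) : scm_matrix T (option bool) :=
  SCMMatrix [:: (None, [::]); (Some false, [:: S])]
    (Some (A :: run ij.1 ++ S :: S :: run ij.2 ++ [:: A])) None.
Definition unmark_matrix : scm_matrix T (option bool) :=
  SCMMatrix [:: (None, [::]); (None, [::])] (Some [:: A; S; S; A]) None.
Definition end_matrix : scm_matrix T (option bool) :=
  SCMMatrix [:: (None, [::]); (None, [::])] None (Some [:: A]).

(* Total run length 3 certifies that two facing blocks carry the same bit; the other
   pairs occur only while such blocks are being erased, because a run of length
   0 occurs nowhere else. *)
Definition eatable : seq (nat * nat) := [:: (1, 2); (2, 1); (0, 2); (2, 0); (0, 1); (1, 0)].

Definition matrices : seq (scm_matrix T (option bool)) :=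
  [:: start_matrix; stop_matrix; mark_matrix; unmark_matrix; end_matrix] ++
  map eat_matrix eatable ++ map push_matrix tl.

Definition tiling_grammar : scm_grammar T := @SCMGrammar T (option bool) (Some false) matrices.

Local Notation step := (@scm_step T tiling_grammar).

(** The 7 is the length of [A B^i S S B^j A] with i + j = 3. Each matrix carries exactly one of the
    two conditions, so the count of non-simple ones is 0. *)
Lemma scm_params_tiling_grammar : scm_params tiling_grammar 7 2 (Some 3) None (Some 2) (Some 3).
Proof.
split=> [r|].
  rewrite In_seq_cat In_seq_cat !In_seq_map.
  case=> [/=[<-|[<-|[<-|[<-|[<-|[]]]]]]|[[ij + ->]|[t _ ->]]] //.
  by rewrite !inE; do ! case/orP=> [/eqP->//|]; move/eqP=> ->.
split; first by rewrite /= card_option card_bool.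
split=> //; rewrite -[scm_M _]/matrices !count_cat !count_map /=.
by rewrite !(@eq_count _ _ pred0) ?count_pred0.
Qed.

(** * Unique reading of block words *)

Lemma factor1 (x : V) p : is_factor [:: x] p <-> x \in p.
Proof.
split=> [[u [w ->]]|]; first by rewrite !mem_cat mem_head orbT.
by case/path.splitPr=> u w; exists u, w.
Qed.

Lemma S_left_word X : S \notin left_word X.
Proof.
elim: X => // x X IH; rewrite -[left_word _]/(left_block x ++ left_word X).
by rewrite mem_cat (negPf IH) orbF; case: x => // -[].
Qed.

Lemma S_right_word Y : S \notin right_word Y.
Proof.
elim: Y => // c Y IH.
by rewrite -[right_word _]/((_ ++ _) ++ right_word Y) !mem_cat (negPf IH) orbF; case: c.
Qed.

Lemma S_run n : S \notin run n.
Proof. by apply/negP => /nseqP[]. Qed.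

Lemma A_run n : A \notin run n.
Proof. by apply/negP => /nseqP[]. Qed.

Lemma runS n : run n.+1 = run n ++ [:: B].
Proof. by rewrite /run -addn1 nseqD. Qed.

Lemma run_inj n m : run n = run m -> n = m.
Proof. by move/(congr1 size); rewrite !size_nseq. Qed.

Lemma left_word_cat X X' : left_word (X ++ X') = left_word X ++ left_word X'.
Proof. by rewrite /left_word map_cat flatten_cat. Qed.

Lemma left_word_rcons X c :
  left_word (rcons X (inl c)) = left_word X ++ A :: run (lrun c).
Proof. by rewrite -cats1 left_word_cat /left_word /= cats0. Qed.

Lemma right_word_cons c Y :
  right_word (c :: Y) = run (rrun c) ++ A :: right_word Y.
Proof. by rewrite /right_word /= -catA. Qed.

Lemma right_word_cat Y Y' : right_word (Y ++ Y') = right_word Y ++ right_word Y'.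
Proof. by rewrite /right_word map_cat flatten_cat. Qed.

Lemma right_word_noAA Y p q : right_word Y <> p ++ A :: A :: q.
Proof.
elim: Y p => [|c Y IH] p; first by case: p.
rewrite right_word_cons; case: p => [|x p]; first by case: c.
have noA Z r : right_word Z <> A :: r by case: Z => // -[].
case: c => /=.
  case=> _; case: p => [[/noA]|x' p [_ /IH]] //.
case=> _; case: p => [|x' p] //= [_]; case: p => [[/noA]|? p [_ /IH]] //.
Qed.

Lemma right_word_neqA Y q : right_word Y <> A :: q.
Proof. by case: Y => // -[]. Qed.

(** Bit blocks on the left end, and those on the right begin, with a nonempty run of [B]; hence two
    letters [A] are adjacent only at the centre. *)
Lemma AA_unique X Y p q : left_word X ++ A :: A :: right_word Y = p ++ A :: A :: q ->
  p = left_word X /\ q = right_word Y.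
Proof.
elim: X p => [|x X IH] p.
  case: p => [[->]|x [|x' p]] //=; first by case=> _ /right_word_neqA.
  by case=> _ _ /right_word_noAA.
case: x => [c|a].
  rewrite /left_word /=; case: p => [|x p]; first by case: c.
  case: c; case: p => [|x' p] //= [<-] //; last by case=> <- /IH[-> ->].
  by case=> <-; case: p => [|x'' p] //= [<-] /IH[-> ->].
by case: p => [|x p] //= [<-] /IH[-> ->].
Qed.

Lemma left_word_suffix X p i : left_word X = p ++ A :: run i ->
  exists X' c, [/\ X = rcons X' (inl c), i = lrun c & p = left_word X'].
Proof.
case/lastP: X => [|X [c|a]]; first by case: p.
  rewrite left_word_rcons => /last_split[]; rewrite ?A_run // => <- /run_inj <-.
  by exists X, c.
rewrite -cats1 left_word_cat => /(congr1 (last S)); rewrite !last_cat.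
by case: i => [|i] //; rewrite runS -cat_cons last_cat.
Qed.

Lemma right_word_prefix Y q j : right_word Y = run j ++ A :: q ->
  exists c Y', [/\ Y = c :: Y', j = rrun c & q = right_word Y'].
Proof.
case: Y => [|c Y]; first by case: j.
rewrite right_word_cons => /first_split[]; rewrite ?A_run // => /run_inj <- <-.
by exists c, Y.
Qed.

Lemma In_matricesP r : In_seq r matrices ->
  [\/ r = start_matrix, r = stop_matrix, r = mark_matrix | r = unmark_matrix] \/
  [\/ r = end_matrix, exists2 ij, ij \in eatable & r = eat_matrix ij
    | exists2 t, t \in tl & r = push_matrix t].
Proof.
rewrite /matrices !In_seq_cat !In_seq_map.
case=> [/=[<-|[<-|[<-|[<-|[<-|[]]]]]]|[ex|ex]].
- by left; constructor 1.
- by left; constructor 2.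
- by left; constructor 3.
- by left; constructor 4.
- by right; constructor 1.
- by right; constructor 2.
by right; constructor 3.
Qed.

(** * Effect of a matrix on a word with two markers *)

Lemma apply_two n x n' x' (z y : seq V) : apply_rules [:: (n, x); (n', x')] z y ->
  exists u w u' w', [/\ z = u ++ inr n :: w, u ++ x ++ w = u' ++ inr n' :: w'
                      & y = u' ++ x' ++ w'].
Proof.
move=> H; inversion H as [|n0 x0 rs u w y0 H' E1 E2 E3]; subst.
inversion H' as [|n1 x1 rs u' w' y1 H'' E1 E2 E3]; subst.
by inversion H''; subst; exists u, w, u', w'.
Qed.

Lemma apply_one n x (z y : seq V) : apply_rules [:: (n, x)] z y ->
  exists u w, z = u ++ inr n :: w /\ y = u ++ x ++ w.
Proof.
move=> H; inversion H as [|n0 x0 rs u w y0 H' E1 E2 E3]; subst.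
by inversion H'; subst; exists u, w.
Qed.

Definition clean (p m q : seq V) : bool := [&& S \notin p, S \notin m & S \notin q].

Lemma marked_at p m q u w : clean p m q -> marked p m q = u ++ S :: w ->
  (u = p /\ w = m ++ S :: q) \/ (u = p ++ S :: m /\ w = q).
Proof.
case/and3P=> Sp Sm Sq E; case: (boolP (S \in u)) => [Su|Su]; last first.
  by left; have [-> ->] := first_split Sp Su E.
case/path.splitPr: u / Su E => u1 u2; rewrite -catA => E.
by right; have [-> -> ->] := double_split Sp Sm Sq E.
Qed.

Lemma single_at p q u w : S \notin p -> S \notin q -> p ++ S :: q = u ++ S :: w ->
  u = p /\ w = q.
Proof.
move=> Sp Sq E; case: (boolP (S \in u)) => [Su|Su]; last first.
  by have [-> ->] := first_split Sp Su E.
case/path.splitPr: u / Su E => u1 u2; rewrite -catA => E.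
have /(congr1 (cons S)) E' := E; rewrite -[S :: p ++ _]/(marked [::] p q) in E'.
have c : clean [::] p q by rewrite /clean Sp Sq.
have [[]|[_ qE]] // := marked_at c (u := S :: u1) E'.
by rewrite -qE mem_cat mem_head orbT in Sq.
Qed.

Lemma factor_marked a m' b p m q : clean p m q ->
  is_factor (a ++ S :: m' ++ S :: b) (marked p m q) ->
  exists p' q', [/\ p = p' ++ a, m = m' & q = b ++ q'].
Proof.
case/and3P=> Sp Sm Sq [u [w]]; rewrite -!catA /= -catA /= catA.
by case/(double_split Sp Sm Sq) => -> -> ->; exists u, w.
Qed.

Lemma apply_erase_marked p m q y : clean p m q ->
  apply_rules [:: (None, [::]); (None, [::])] (marked p m q) y -> y = p ++ m ++ q.
Proof.
move=> c /apply_two[u [w [u' [w' [/(marked_at c) E1 E2 ->]]]]].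
case/and3P: c => Sp Sm Sq; case: E1 E2 => -[-> ->].
  by rewrite /= catA; case/single_at; rewrite ?mem_cat ?negb_or ?Sp // => -> ->; rewrite catA.
rewrite /= -catA; case/single_at; rewrite ?mem_cat ?negb_or ?Sm // => -> ->.
by [].
Qed.

(** Either rule may hit either marker, which gives four outcomes; only the first is intended. *)
Lemma apply_push_marked p m q v u y : clean p m q -> S \notin v -> S \notin u ->
  apply_rules [:: (None, v ++ [:: S]); (None, S :: u)] (marked p m q) y ->
  [\/ y = marked (p ++ v) m (u ++ q), y = marked (p ++ v) (u ++ m) q,
      y = marked p (u ++ m ++ v) q | y = marked p (m ++ v) (u ++ q)].
Proof.
move=> c Sv Su /apply_two[l [w [l' [w' [/(marked_at c) E1 E2 ->]]]]].
case/and3P: c => Sp Sm Sq.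
case: E1 E2 => -[-> ->]; rewrite -?catA /= => E2.
  have c : clean (p ++ v) m q by rewrite /clean mem_cat negb_or Sp Sv Sm.
  move: E2; rewrite catA; case/(marked_at c) => -[-> ->].
    by constructor 2; rewrite /marked -!catA.
  by constructor 1; rewrite /marked /= -?catA /= -?catA.
have c : clean p (m ++ v) q by rewrite /clean mem_cat negb_or Sp Sv Sm.
rewrite [m ++ _]catA in E2; case/(marked_at c): E2 => -[-> ->].
  by constructor 3; rewrite /marked -!catA.
by constructor 4; rewrite /marked /= -?catA /= -?catA.
Qed.

Lemma apply_eat_marked p q y : clean p [::] q ->
  apply_rules [:: (None, [::]); (Some false, [:: S])] (marked p [::] q) y ->
  (exists l r, p = l ++ B :: r /\ y = marked l r q) \/
  (exists l r, q = l ++ B :: r /\ y = marked p l r).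
Proof.
move=> c /apply_two[l [w [l' [w' [/(marked_at c) E1 E2 ->]]]]].
have {E1} : p ++ S :: q = l' ++ B :: w'.
  by case: E1 E2 => -[-> ->]; rewrite ?cats1 ?cat_rcons.
case/(@cross_split _ S B) => // -[r -> ->].
  by left; exists l', r; rewrite /marked -?catA.
by right; exists r, w'; rewrite /marked -?catA.
Qed.

(** The conditions sort the matrices: [S A A S] for stopping and pushing, adjacent markers for
    eating and unmarking, no [A] for ending and starting. [mark_matrix] is blocked by the markers.
    For [start_matrix] only the presence of [B] is recorded, which suffices to exclude it later. *)
Lemma marked_step p m q y : clean p m q -> step (marked p m q) y ->
  [\/ m = [:: A; A] /\ (y = p ++ m ++ q \/ exists2 t, t \in tl &
        apply_rules (mx_rules (push_matrix t)) (marked p m q) y),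
      m = [::] /\ exists2 ij, ij \in eatable &
        [/\ exists p', p = p' ++ A :: run ij.1, exists q', q = run ij.2 ++ A :: q' &
         (exists l r, p = l ++ B :: r /\ y = marked l r q) \/
         (exists l r, q = l ++ B :: r /\ y = marked p l r)],
      [/\ m = [::], exists p', p = p' ++ [:: A], exists q', q = A :: q' & y = p ++ q]
    | A \notin p ++ m ++ q /\ (y = p ++ m ++ q \/ B \in p ++ m ++ q)].
Proof.
move=> c [r [/In_matricesP + [+ [+ +]]]].
have mem_marked x : x != S -> (x \in marked p m q) = (x \in p ++ m ++ q).
  by move=> /negPf xS; rewrite !(mem_cat, inE) xS.
case=> [[]|[]].
- move=> -> _ /= nA H; constructor 4.
  have {}nA : A \notin p ++ m ++ q by rewrite -mem_marked //; apply/negP => /factor1.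
  split=> //; right; have [u [w [E _]]] := apply_one H.
  by rewrite -mem_marked // E mem_cat mem_head orbT.
- move=> -> P _ H; constructor 1.
  have [p' [q' [_ -> _]]] := @factor_marked [::] [:: A; A] [::] _ _ _ c P.
  split=> //; left; move: H => /= /(apply_erase_marked c).
  by have [_ [_ [_ -> _]]] := @factor_marked [::] [:: A; A] [::] _ _ _ c P.
- move=> -> _ /= [].
  by apply/factor1; rewrite /marked mem_cat mem_head orbT.
- move=> -> P _ H.
  have [p' [q' [pE mE qE]]] := @factor_marked [:: A] [::] [:: A] _ _ _ c P.
  constructor 3; split=> //; [by exists p' | by exists q' |].
  by move: H => /= /(apply_erase_marked c); rewrite mE.
- move=> -> _ /= nA /(apply_erase_marked c) yE; constructor 4; split; last by left.
  by rewrite -mem_marked //; apply/negP => /factor1.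
- case=> ij ije -> P _ H; rewrite /= -cat_cons in P.
  have [p' [q' [pE mE qE]]] := @factor_marked _ [::] _ _ _ _ c P.
  constructor 2; split=> //; exists ij => //; split; [by exists p' | |].
    by exists q'; rewrite qE -catA.
  by move: c H; rewrite mE => c /(apply_eat_marked c).
case=> t tt -> P _ H; constructor 1.
have [p' [q' [_ mE _]]] := @factor_marked [::] [:: A; A] [::] _ _ _ c P.
by split=> //; right; exists t.
Qed.

(** * Soundness of the tiling grammar: an invariant of its derivations *)

Definition good (X : seq (bool + T)) (Y : seq bool) : Prop :=
  forall w, X = map inr w ++ map inl (rev Y) -> lang w.

(** [good] is an implication, vacuous for words that do not match, so cancelling equal bits at the
    centre preserves it. *)
Lemma good_pop X Y c : good (rcons X (inl c)) (c :: Y) -> good X Y.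
Proof. by move=> g w E; apply: g; rewrite E rev_cons map_rcons -rcons_cat. Qed.

Lemma good_tiling ps : {subset ps <= tl} -> good (tops ps) (rev (init ++ bots ps)).
Proof. by move=> sub w E; exists ps => //; rewrite E revK. Qed.

Lemma tops_rcons (ps : seq (seq (bool + T) * seq bool)) t :
  tops (rcons ps t) = tops ps ++ t.1.
Proof. by rewrite /tops /unzip1 map_rcons flatten_rcons. Qed.

Lemma bots_rcons (ps : seq (seq (bool + T) * seq bool)) t :
  bots (rcons ps t) = bots ps ++ t.2.
Proof. by rewrite /bots /unzip2 map_rcons flatten_rcons. Qed.

Lemma A_left_word X : A \notin left_word X -> exists w, X = map inr w.
Proof.
elim: X => [|[c|a] X IH] nA; first by exists [::].
  by rewrite -[left_word _]/((A :: run (lrun c)) ++ left_word X) mem_head in nA.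
by case: IH => // w ->; exists (a :: w).
Qed.

Lemma A_right_word Y : A \notin right_word Y -> Y = [::].
Proof. by case: Y => // c Y; rewrite right_word_cons mem_cat mem_head orbT. Qed.

Lemma left_word_inr w : left_word (map inr w) = map inl w.
Proof. by elim: w => //= a w <-. Qed.

(* In [inv_stuck] the two markers are misplaced: every matrix is blocked there. *)
Inductive inv : seq V -> Prop :=
| inv_start : inv [:: B]
| inv_push ps of {subset ps <= tl} : inv
    (marked (left_word (tops ps)) [:: A; A] (right_word (rev (init ++ bots ps))))
| inv_idle X Y of good X Y : inv (left_word X ++ A :: A :: right_word Y)
| inv_meet X Y of good X Y : inv (marked (left_word X) [::] (right_word Y))
| inv_eat X Y i j of good X Y :
    inv (marked (left_word X ++ A :: run i) [::] (run j ++ A :: right_word Y))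
| inv_stuck p m q of clean p m q & m != [::] & m != [:: A; A] & A \in p ++ m ++ q :
    inv (marked p m q)
| inv_done w of lang w : inv (map inl w).

Lemma inv_marked p m q : clean p m q -> A \in p ++ m ++ q ->
  (m = [::] -> inv (marked p m q)) -> m <> [:: A; A] -> inv (marked p m q).
Proof.
move=> c Ain inv0 mAA; have [m0|m0] := eqVneq m [::]; first exact: inv0.
by apply: inv_stuck => //; apply/eqP.
Qed.

(** Consuming the innermost [B] shortens a run. Any other [B] leaves a nonempty middle, which is
    never [A A] because complete blocks face the centre with a nonempty run; the word is then
    stuck. *)
Lemma inv_eat_step X Y i j y : good X Y ->
  let p := left_word X ++ A :: run i in let q := run j ++ A :: right_word Y in
  (exists l r, p = l ++ B :: r /\ y = marked l r q) \/
  (exists l r, q = l ++ B :: r /\ y = marked p l r) -> inv y.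
Proof.
move=> g p q.
have Sp : S \notin p by rewrite mem_cat inE !negb_or S_left_word S_run.
have Sq : S \notin q by rewrite mem_cat inE !negb_or S_right_word S_run.
case=> -[l [r [E ->]]].
  have c : clean l r q.
    by move: Sp; rewrite E mem_cat inE !negb_or => /and3P[Sl _ Sr]; apply/and3P.
  apply: inv_marked => //.
  - by rewrite /q !mem_cat mem_head !orbT.
  - move=> r0; move: E; rewrite /p r0; case: i {p Sp} => [|i].
      by move/(congr1 (last S)); rewrite !last_cat.
    rewrite runS !cats1 -rcons_cons -rcons_cat => /rcons_inj[<-].
    exact: inv_eat.
  move=> rAA; move: E; rewrite /p rAA; case: i {p Sp} => [|i].
    rewrite -[[:: B; A; A]]/([:: B; A] ++ [:: A]) catA !cats1 => /rcons_inj[].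
    rewrite -[[:: B; A]]/([:: B] ++ A :: run 0) catA.
    by case/left_word_suffix => X' [[] []].
  by move/(congr1 (last S)); rewrite runS -cat_cons !last_cat.
have c : clean p l r.
  by move: Sq; rewrite E mem_cat inE !negb_or => /and3P[Sl _ Sr]; apply/and3P.
apply: inv_marked => //.
- by rewrite /p !mem_cat mem_head !orbT.
- move=> l0; move: E; rewrite /q l0; case: j {q Sq} => [|j] //= [<-].
  exact: inv_eat.
move=> lAA; move: E; rewrite /q lAA; case: j {q Sq} => [|j] //= [].
exact: right_word_neqA.
Qed.

Lemma clean_words X Y m : S \notin m -> clean (left_word X) m (right_word Y).
Proof. by move=> Sm; rewrite /clean S_left_word Sm S_right_word. Qed.

Lemma inv_step x y : inv x -> step x y -> inv y.
Proof.
case=> {x} [|ps sub|X Y g|X Y g|X Y i j g|p m q c m0 mAA Ain|w Lw].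
(* On the start symbol every matrix but [start_matrix] requires or rewrites an absent [S] or [A]. *)
- move=> [r [/In_matricesP + [+ [+ +]]]].
  have noS P : S \in P -> ~ is_factor P [:: B].
    move=> SP [u [w E]]; suff: S \in [:: B] by [].
    by rewrite E !mem_cat SP orbT.
  have one (u w : seq V) n : [:: B] = u ++ n :: w -> [/\ u = [::], n = B & w = [::]].
    by case: u => [[-> ->]|? []].
  case=> [[]|[]].
  + move=> -> _ _ /apply_one[u [w [/one[-> _ ->] ->]]]; rewrite cats0.
    by rewrite -[init]cats0; apply: (@inv_push [::]).
  + by move=> -> /noS[].
  + by move=> -> _ _ /apply_two[u [w [u' [w' [E]]]]]; case: (one _ _ _ E).
  + by move=> -> /noS[].
  + by move=> -> _ _ /apply_two[u [w [u' [w' [E]]]]]; case: (one _ _ _ E).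
  + by case=> ij _ -> /noS[]; rewrite !(mem_cat, inE) eqxx !orbT.
  + by case=> ij _ -> /noS[].
- set X := tops ps; set Y := rev _.
  have c : clean (left_word X) [:: A; A] (right_word Y) by apply: clean_words.
  case/(marked_step c) => [[_ [->|[t tt]]]|[]|[]|[]] //.
  + exact/inv_idle/good_tiling.
  + have [Sv Su] := (S_left_word t.1, S_right_word (rev t.2)).
    have push : inv (marked (left_word X ++ left_word t.1) [:: A; A]
        (right_word (rev t.2) ++ right_word Y)).
      rewrite -left_word_cat -tops_rcons -right_word_cat /Y -rev_cat -catA -bots_rcons.
      apply: inv_push => z; rewrite mem_rcons inE => /predU1P[->//|]; exact: sub.
    move: push; set u := right_word (rev _) in Su *; set v := left_word t.1 in Sv * => push.
    case/and3P: (c) => SX _ SY; case/(apply_push_marked c Sv Su) => ->.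
    * exact: push.
    (* For this and the next two misdirected pushes: if the part that landed in the middle is empty,
       the outcome is the intended one; otherwise the middle is longer than [A A] and the word is
       stuck. *)
    * have [u0|u0] := eqVneq u [::]; first by move: push; rewrite u0.
      apply: inv_stuck; first by rewrite /clean !mem_cat !negb_or SX Sv Su.
      - by case: (u) u0.
      - by apply: contra_neq u0 => /(congr1 size) /eqP; rewrite size_cat addn2 eqSS => /nilP.
      by rewrite !mem_cat mem_head !orbT.
    * have [uv0|uv0] := eqVneq (u ++ v) [::].
        have [u0 v0] : u = [::] /\ v = [::] by case: (u) (v) uv0 => [|? ?] [|? ?].
        by move: push; rewrite u0 v0 !cats0.
      apply: inv_stuck; first by rewrite /clean !mem_cat !negb_or SX SY Sv Su.
      - by case: (u).
      - apply: contra_neq uv0 => /(congr1 size); rewrite !size_cat /= => C.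
        by apply: size0nil; rewrite size_cat; lia.
      by rewrite !mem_cat mem_head !orbT.
    * have [v0|v0] := eqVneq v [::]; first by move: push; rewrite v0 !cats0.
      apply: inv_stuck; first by rewrite /clean !mem_cat !negb_or SX SY Sv Su.
      - by [].
      - by apply: contra_neq v0 => -[].
      by rewrite !mem_cat mem_head !orbT.
  + by move=> nA; rewrite !mem_cat mem_head !orbT in nA.
- move=> [r [/In_matricesP + [+ [+ +]]]].
  set z := _ ++ _; have Sz : S \notin z.
    by rewrite mem_cat !inE !negb_or S_left_word S_right_word.
  have Az : A \in z by rewrite mem_cat mem_head orbT.
  have noS P : S \in P -> ~ is_factor P z.
    by move=> SP [u [w E]]; move: Sz; rewrite E !mem_cat SP orbT.
  case=> [[]|[]].
  + by move=> -> _ /= /factor1; rewrite Az.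
  + by move=> -> /noS[].
  + move=> -> _ _ /apply_two[u [w [u' [w' [E E' ->]]]]].
    have E2 p m q : z = p ++ A :: m ++ A :: q -> inv (marked p m q).
      move=> zE; have c : clean p m q.
        move: Sz; rewrite zE !(mem_cat, inE) !negb_or.
        by case/and4P=> Sp _ Sm /andP[_ Sq]; apply/and3P.
      (* Marked letters with nothing between them are the central pair, by [AA_unique]; with [A A]
         between them there would be four letters [A] in a row. *)
      have [m0|m0] := eqVneq m [::].
        move: zE; rewrite m0 => /AA_unique[-> ->]; exact: inv_meet.
      have [mA|mA] := eqVneq m [:: A; A].
        by move: zE; rewrite mA => /AA_unique[_ /esym/right_word_neqA].
      apply: inv_stuck => //; apply: contraT.
      rewrite !mem_cat !negb_or => /and3P[Ap Am Aq].
      (* If no [A] remained, the marked letters would be the only two, hence the central ones, and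
         [m] would be empty. *)
      have AX : A \notin left_word X.
        have := congr1 (count_mem A) zE; rewrite !count_cat /= !count_cat /=.
        rewrite (count_memPn Ap) (count_memPn Am) (count_memPn Aq) => C.
        move/eqP: C; rewrite !add0n !add1n !addnS !eqSS addn_eq0 => /andP[/eqP ? _].
        exact/count_memPn.
      have [_] := first_split AX Ap zE.
      case: (m) m0 Am => // x m' _; rewrite inE negb_or => /andP[/eqP Ax _].
      by case=> /Ax.
    case/(@cross_split _ S A): E' E => // -[m -> ->]; rewrite -?catA /= => E.
      exact: E2.
    exact: E2.
  + by move=> -> /noS[].
  + by move=> -> _ /= /factor1; rewrite Az.
  + by case=> ij _ -> /noS[]; rewrite !(mem_cat, inE) eqxx !orbT.
  + by case=> t _ -> /noS[].
- have c : clean (left_word X) [::] (right_word Y) by apply: clean_words.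
  case/(marked_step c) => [[]|[_ [ij ije [[p' pE] [q' qE] H]]]|[_ [p' pE] [q' qE] yE]|[nA]] //.
  + have [X' [b [XE b1 _]]] := left_word_suffix pE.
    have [b' [Y' [YE b2 _]]] := right_word_prefix qE.
    (* Both runs are nonempty, so membership in [eatable] leaves only (1, 2) and (2, 1): the facing
       bits agree. *)
    have bb : b' = b by move: ije; case: ij b1 b2 {pE qE} => i j /= -> ->; case: b {XE}; case: b' {YE}.
    subst X Y b'; apply: (@inv_eat_step X' Y' (lrun b) (rrun b) _ (good_pop g)).
    by rewrite -left_word_rcons -right_word_cons; apply: H.
  (* Unmarking needs a run of length 0 at the centre, which no complete block has. *)
  + by have [? [[] []]] := left_word_suffix (i := 0) pE.
  + move: nA; rewrite mem_cat negb_or => /andP[/A_left_word[w XE] /A_right_word YE].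
    rewrite {}XE {}YE in g c *; rewrite left_word_inr cats0.
    case=> [->|]; last by case/mapP.
    by apply: inv_done; apply: g; rewrite cats0.
- set p := _ ++ _; set q := _ ++ _.
  have c : clean p [::] q.
    by rewrite /clean !mem_cat !inE !negb_or S_left_word S_right_word !S_run.
  case/(marked_step c) => [[]|[_ [ij _ [_ _ H]]]|[_ [p' pE] [q' qE] ->]|[]] //.
  + exact: (inv_eat_step g H).
  + have [_ i0] : left_word X = p' /\ run i = [::].
      by move: pE => /last_split; apply; rewrite ?A_run.
    have [j0 _] : run j = [::] /\ right_word Y = q'.
      by move: qE => /(first_split (p' := [::])); apply; rewrite ?A_run.
    by rewrite /p /q i0 j0 -catA; apply: inv_idle.
  + by rewrite !mem_cat mem_head !orbT.
- case/(marked_step c) => [[mE]|[mE]|[mE]|[]]; rewrite ?mE // in m0 mAA *.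
  by rewrite Ain.
- move=> [r [/In_matricesP rM [_ [_ H]]]].
  have no (u v : seq V) n : map inl w <> u ++ inr n :: v.
    move=> E; have : inr n \in map inl w by rewrite E mem_cat mem_head orbT.
    by case/mapP.
  case: rM H => [[]|[]] => [->|->|->|->|->|[? _ ->]|[? _ ->]].
  + by case/apply_one=> [? [? [/no]]].
  all: by case/apply_two=> [? [? [? [? [/no]]]]].
Qed.

(** * Completeness of the tiling grammar: an explicit derivation *)

Lemma apply_twoI n x n' x' (u w u' w' : seq V) :
  u ++ x ++ w = u' ++ inr n' :: w' ->
  apply_rules [:: (n, x); (n', x')] (u ++ inr n :: w) (u' ++ x' ++ w').
Proof. by move=> E; constructor; rewrite E; do 2! constructor. Qed.

Lemma eat_step i j l q y : (i, j) \in eatable ->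
  apply_rules (mx_rules (eat_matrix (i, j)))
    (marked (l ++ A :: run i) [::] (run j ++ A :: q)) y ->
  step (marked (l ++ A :: run i) [::] (run j ++ A :: q)) y.
Proof.
move=> ije H; exists (eat_matrix (i, j)); split.
  by rewrite !In_seq_cat !In_seq_map; right; left; exists (i, j).
split; last by split.
by exists l, q; rewrite /marked -?catA /= -?catA /= -?catA.
Qed.

Lemma eat_left i j l q : (i.+1, j) \in eatable ->
  step (marked (l ++ A :: run i.+1) [::] (run j ++ A :: q))
       (marked (l ++ A :: run i) [::] (run j ++ A :: q)).
Proof.
move=> ije; apply: (eat_step ije); rewrite /marked runS.
apply: (@apply_twoI None [::] (Some false) [:: S] _ (S :: _) (l ++ A :: run i) (S :: _)).
by rewrite -?catA /= -?catA.
Qed.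

Lemma eat_right i j l q : (i, j.+1) \in eatable ->
  step (marked (l ++ A :: run i) [::] (run j.+1 ++ A :: q))
       (marked (l ++ A :: run i) [::] (run j ++ A :: q)).
Proof.
move=> ije; apply: (eat_step ije).
set u := l ++ _; have -> : marked u [::] (run j ++ A :: q) =
  (u ++ [:: S]) ++ [:: S] ++ run j ++ A :: q by rewrite /marked -catA.
by apply: (@apply_twoI None [::] (Some false) [:: S] u (S :: _)); rewrite -catA.
Qed.

Lemma mark_step p q : step (p ++ A :: A :: q) (marked p [::] q) \/ S \in p ++ q.
Proof.
case: (boolP (S \in p ++ q)) => [|nS]; [by right | left].
exists mark_matrix; split; first by rewrite !In_seq_cat /=; tauto.
split=> //; split.
  by move=> /factor1; move: nS; rewrite !(mem_cat, inE) !negb_or => /andP[/negPf-> /negPf->].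
have -> : marked p [::] q = (p ++ [:: S]) ++ [:: S] ++ q by rewrite /marked -catA.
by apply: (@apply_twoI (Some true) [:: S] (Some true) [:: S] p (A :: q)); rewrite -catA.
Qed.

Lemma unmark_step l q :
  step (marked (l ++ [:: A]) [::] (A :: q)) (l ++ A :: A :: q).
Proof.
exists unmark_matrix; split; first by rewrite !In_seq_cat /=; tauto.
split; first by exists l, q; rewrite /marked -catA.
split=> //; rewrite -[l ++ _ :: _ :: _]/(l ++ [:: A] ++ [::] ++ A :: q) catA.
by apply: (@apply_twoI None [::] None [::] _ (S :: A :: q)).
Qed.

(** The run of length 1 is emptied first: the run lengths then pass through pairs containing 0 and
    avoid (1, 1), which also arises from the disagreeing bits [false] and [true]. *)
Lemma pop_steps X c Y :
  rtc step (left_word (rcons X (inl c)) ++ A :: A :: right_word (c :: Y))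
           (left_word X ++ A :: A :: right_word Y).
Proof.
have [m|] := mark_step (left_word (rcons X (inl c))) (right_word (c :: Y)); last first.
  by rewrite mem_cat (negPf (S_left_word _)) (negPf (S_right_word _)).
apply: rtc_step m _; rewrite left_word_rcons right_word_cons.
apply: rtc_snoc (unmark_step _ _); case: c => /=.
  apply: rtc_step (eat_right _ _ (isT : (2, 1) \in eatable)) _.
  apply: rtc_step (eat_left _ _ (isT : (2, 0) \in eatable)) _.
  exact: rtc_one (eat_left _ _ (isT : (1, 0) \in eatable)).
apply: rtc_step (eat_left _ _ (isT : (1, 2) \in eatable)) _.
apply: rtc_step (eat_right _ _ (isT : (0, 2) \in eatable)) _.
exact: rtc_one (eat_right _ _ (isT : (0, 1) \in eatable)).
Qed.

Lemma clear_steps w Y :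
  rtc step (left_word (map inr w ++ map inl (rev Y)) ++ A :: A :: right_word Y)
           (map inl w).
Proof.
elim: Y => [|c Y IH]; last first.
  rewrite rev_cons map_rcons -rcons_cat; apply: rtc_trans IH; exact: pop_steps.
rewrite cats0 left_word_inr.
have [m|] := mark_step (map inl w) [::]; last by rewrite cats0 => /mapP[].
apply: rtc_step m _; apply: rtc_one.
exists end_matrix; split; first by rewrite !In_seq_cat /=; tauto.
split=> //; split.
  by move=> /factor1; rewrite /marked mem_cat !inE !orbF => /mapP[].
rewrite -{2}[map inl w]cats0.
by apply: (@apply_twoI None [::] None [::] (map inl w) [:: S] (map inl w) [::]).
Qed.

Lemma push_steps ps : {subset ps <= tl} -> rtc step [:: B]
  (marked (left_word (tops ps)) [:: A; A] (right_word (rev (init ++ bots ps)))).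
Proof.
(* Each new tile is pushed innermost, hence induction from the end of the list. *)
elim/last_ind: ps => [|ps t IH] sub.
  rewrite cats0; apply: rtc_one; exists start_matrix; split; first by left.
  split=> //; split; first by move=> /factor1.
  by rewrite -[marked _ _ _]cats0; apply: (@ar_cons _ _ _ _ _ [::] [::]); constructor.
apply: rtc_snoc (IH _) _; first by move=> x xs; apply: sub; rewrite mem_rcons inE xs orbT.
exists (push_matrix t); split.
  rewrite !In_seq_cat !In_seq_map; right; right; exists t => //.
  by apply: sub; rewrite mem_rcons mem_head.
split; first by exists (left_word (tops ps)), (right_word (rev (init ++ bots ps))).
split=> //; rewrite tops_rcons bots_rcons catA [rev (_ ++ t.2)]rev_cat left_word_cat right_word_cat.
set l := left_word (tops ps); set r := right_word (rev (init ++ _)).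
have -> : marked (l ++ left_word t.1) [:: A; A] (right_word (rev t.2) ++ r) =
    (l ++ left_word t.1 ++ [:: S; A; A]) ++ (S :: right_word (rev t.2)) ++ r.
  by rewrite /marked -!catA.
by apply: (@apply_twoI None _ None _ l [:: A, A, S & r] _ r); rewrite -!catA.
Qed.

Lemma tiling_grammar_lang w : scm_lang tiling_grammar w <-> lang w.
Proof.
split=> [d|[ps sub E]].
  have: inv (map inl w) by apply: rtc_invariant inv_step _ _ d inv_start.
  move zE: (map inl w) => z Iz.
  have no x : inr x \notin z by rewrite -zE; apply/negP => /mapP[].
  case: Iz zE no => {z} [|ps _|X Y _|X Y _|X Y i j _|p m q _ _ _ _|w' Lw'].
  - by move=> _ /(_ (Some false)).
  - by move=> _ /(_ None); rewrite /marked mem_cat mem_head orbT.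
  - by move=> _ /(_ (Some true)); rewrite mem_cat mem_head orbT.
  - by move=> _ /(_ None); rewrite /marked mem_cat mem_head orbT.
  - by move=> _ /(_ None); rewrite /marked mem_cat mem_head orbT.
  - by move=> _ /(_ None); rewrite /marked mem_cat mem_head orbT.
  have inl_inj : injective (@inl T (option bool)) by move=> ? ? [].
  by move=> E _; rewrite (inj_map inl_inj E).
apply: rtc_trans (push_steps sub) _.
set Y := rev _; have {}E : tops ps = map inr w ++ map inl (rev Y) by rewrite revK.
apply: rtc_step (_ : step _ (left_word (tops ps) ++ A :: A :: right_word Y)) _.
  exists stop_matrix; split; first by rewrite !In_seq_cat /=; tauto.
  split; first by exists (left_word (tops ps)), (right_word Y).
  split=> //; rewrite -[A :: A :: right_word Y]/([:: A; A] ++ [::] ++ _) catA.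
  by apply: apply_twoI; rewrite -catA.
by rewrite E; apply: clear_steps.
Qed.

End Grammar.

(** * Running matrices by a phrase-structure grammar *)

Section Programs.
Variables (T N : finType).
Local Notation V := (T + N)%type.

Inductive instr := Present of seq V | Absent of seq V | Rewrite of N & seq V.

Definition exec (i : instr) (x y : seq V) : Prop :=
  match i with
  | Present p => is_factor p x /\ y = x
  | Absent p => ~ is_factor p x /\ y = x
  | Rewrite n z => exists u w, x = u ++ inr n :: w /\ y = u ++ z ++ w
  end.

Fixpoint runs (p : seq instr) (x y : seq V) : Prop :=
  if p is i :: p' then exists z, exec i x z /\ runs p' z y else x = y.

(** Both conditions concern the word before any rewriting, so the tests come first. *)
Definition matrix_program (r : scm_matrix T N) : seq instr :=
  (if mx_P r is Some P then [:: Present P] else [::]) ++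
  (if mx_F r is Some F then [:: Absent F] else [::]) ++
  [seq Rewrite ax.1 ax.2 | ax <- mx_rules r].

Lemma runs_matrix_program r x y : runs (matrix_program r) x y <-> matrix_step r x y.
Proof.
have rulesP rs z : runs [seq Rewrite ax.1 ax.2 | ax <- rs] z y <-> apply_rules rs z y.
  elim: rs z => [|[n a] rs IH] z /=.
    by split=> [->|H]; [constructor | inversion H].
  split=> [[_ [[u [w [-> ->]]] /IH]]|H]; first exact: ar_cons.
  inversion H as [|n0 a0 rs0 u w y0 H' E1 E2 E3]; subst.
  by exists (u ++ a ++ w); split; [exists u, w | apply/IH].
case: r => rs [P|] [F|]; rewrite /matrix_program /matrix_step /=.
- split; first by case=> _ [[? ->] [_ [[? ->] /rulesP]]].
  by case=> ? [? /rulesP ?]; exists x; split=> //; exists x.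
- split; first by case=> _ [[? ->] /rulesP].
  by case=> ? [? /rulesP ?]; exists x.
- split; first by case=> _ [[? ->] /rulesP].
  by case=> ? [? /rulesP ?]; exists x.
by split=> [/rulesP|[_ [_ /rulesP]]].
Qed.

(** * Productions of the simulating grammar *)

Variables (n0 : N) (progs : seq (seq instr)).
Local Notation size_bound := (\max_(i < size progs) size (tnth (in_tuple progs) i)).
Local Notation prog := (tnth (in_tuple progs)).

Definition prog_step (x y : seq V) : Prop := exists i, runs (prog i) x y.
Definition reach (x : seq V) : Prop := rtc prog_step [:: inr n0] x.

(* [inl (i, k, b)] is about to execute instruction [k] of program [i]; the flag [b]
   marks the left-to-right scan that checks the absence of a factor. *)
Definition control := (('I_(size progs) * 'I_size_bound.+1 * bool) + 'I_5)%type.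
Local Notation W := (T + (N + control))%type.

Definition c_start : control := inr (@Ordinal 5 0 isT).
Definition c_left : control := inr (@Ordinal 5 1 isT).
Definition c_right : control := inr (@Ordinal 5 2 isT).
Definition c_idle : control := inr (@Ordinal 5 3 isT).
Definition c_final : control := inr (@Ordinal 5 4 isT).
Definition c_exec i k : control := inl (i, k, false).
Definition c_scan i k : control := inl (i, k, true).
Definition c_next (i : 'I_(size progs)) (k : 'I_size_bound.+1) : control :=
  c_exec i (inord k.+1).

Definition ctl (c : control) : W := inr (inr c).
Definition emb (a : V) : W := match a with inl t => inl t | inr n => inr (inl n) end.
Local Notation L := (ctl c_left).
Local Notation R := (ctl c_right).

(** A scanning control must not wander, because its position certifies that no occurrence starts to
    its left. *)
Definition movable (c : control) : bool :=
  match c with inl (_, _, b) => ~~ b | inr o => 2 < o end.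

Definition words (n : nat) : seq (seq V) := [seq tval t | t <- enum {: n.-tuple V}].

Lemma mem_words n v : (v \in words n) = (size v == n).
Proof.
apply/mapP/eqP => [[t _ ->]|<-]; first by rewrite size_tuple.
by exists (in_tuple v); rewrite ?mem_enum.
Qed.

(* ((u1, c), (u2, v)) stands for the production u1 c u2 -> v. *)
Local Notation production := ((seq W * control) * (seq W * seq W))%type.

(** A scan for [p] starts at the left marker, passes one letter whenever the next [size p] letters
    differ from [p], and ends when fewer than [size p] letters precede the right marker. *)
Definition instr_rules i (k : 'I_size_bound.+1) : seq production :=
  match drop k (prog i) with
  | [::] => [:: (([::], c_exec i k), ([::], [:: ctl c_idle]))]
  | Present p :: _ =>
      [:: (([::], c_exec i k), (map emb p, ctl (c_next i k) :: map emb p))]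
  | Rewrite n x :: _ =>
      [:: (([::], c_exec i k), ([:: emb (inr n)], ctl (c_next i k) :: map emb x))]
  | Absent p :: _ =>
      (([:: L], c_exec i k), ([::], [:: L; ctl (c_scan i k)])) ::
      [seq (([::], c_scan i k),
            (map emb v, map emb (take 1 v) ++ ctl (c_scan i k) :: map emb (behead v)))
      | v <- words (size p) & v != p] ++
      [seq (([::], c_scan i k),
            (map emb v ++ [:: R], ctl (c_next i k) :: map emb v ++ [:: R]))
      | v <- flatten [seq words n | n <- iota 0 (size p)]]
  end.

Definition productions : seq production :=
  [:: (([::], c_start), ([::], [:: L; ctl c_idle; emb (inr n0); R]));
      (([:: L], c_idle), ([::], [:: ctl c_final]));
      (([::], c_final), ([:: R], [::]))] ++
  [seq (([::], c_idle), ([::], [:: ctl (c_exec i ord0)])) | i <- enum {: 'I_(size progs)}] ++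
  [seq (([::], cx.1), ([:: emb cx.2], [:: emb cx.2; ctl cx.1]))
  | cx <- enum {: control * V} & movable cx.1] ++
  [seq (([:: emb cx.2], cx.1), ([::], [:: ctl cx.1; emb cx.2]))
  | cx <- enum {: control * V} & movable cx.1] ++
  flatten [seq instr_rules ik.1 ik.2 | ik <- enum {: 'I_(size progs) * 'I_size_bound.+1}].

Inductive rule : seq W -> control -> seq W -> seq W -> Prop :=
| r_start : rule [::] c_start [::] [:: L; ctl c_idle; emb (inr n0); R]
| r_final : rule [:: L] c_idle [::] [:: ctl c_final]
| r_end : rule [::] c_final [:: R] [::]
| r_pick i : rule [::] c_idle [::] [:: ctl (c_exec i ord0)]
| r_right c a of movable c : rule [::] c [:: emb a] [:: emb a; ctl c]
| r_left c a of movable c : rule [:: emb a] c [::] [:: ctl c; emb a]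
| r_done i k of drop (k : 'I_size_bound.+1) (prog i) = [::] :
    rule [::] (c_exec i k) [::] [:: ctl c_idle]
| r_present i k p s of drop (k : 'I_size_bound.+1) (prog i) = Present p :: s :
    rule [::] (c_exec i k) (map emb p) (ctl (c_next i k) :: map emb p)
| r_rewrite i k n x s of drop (k : 'I_size_bound.+1) (prog i) = Rewrite n x :: s :
    rule [::] (c_exec i k) [:: emb (inr n)] (ctl (c_next i k) :: map emb x)
| r_scan_start i k p s of drop (k : 'I_size_bound.+1) (prog i) = Absent p :: s :
    rule [:: L] (c_exec i k) [::] [:: L; ctl (c_scan i k)]
| r_scan i k p s a v of drop (k : 'I_size_bound.+1) (prog i) = Absent p :: s &
      size (a :: v) = size p & a :: v != p :
    rule [::] (c_scan i k) (map emb (a :: v)) (emb a :: ctl (c_scan i k) :: map emb v)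
| r_scan_end i k p s v of drop (k : 'I_size_bound.+1) (prog i) = Absent p :: s &
      size v < size p :
    rule [::] (c_scan i k) (map emb v ++ [:: R]) (ctl (c_next i k) :: map emb v ++ [:: R]).

Lemma productionsP u1 c u2 v :
  ((u1, c), (u2, v)) \in productions <-> rule u1 c u2 v.
Proof.
split.
  rewrite !mem_cat => /or4P[|/mapP[i _ [-> -> -> ->]]|/mapP[[d a]]|/orP[/mapP[[d a]]|]].
  - rewrite !inE => /or3P[] /eqP[-> -> -> ->]; constructor.
  - exact: r_pick.
  - by rewrite mem_filter => /andP[/= md _] [-> -> -> ->]; apply: r_right.
  - by rewrite mem_filter => /andP[/= md _] [-> -> -> ->]; apply: r_left.
  case/flattenP => _ /mapP[[i k] _ ->]; rewrite /instr_rules /=.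
  case E: (drop k (prog i)) => [|[p|p|n x] s].
  - by rewrite inE => /eqP[-> -> -> ->]; apply: r_done.
  - by rewrite inE => /eqP[-> -> -> ->]; apply: r_present E.
  - rewrite inE mem_cat => /or3P[/eqP[-> -> -> ->]|/mapP[w]|/mapP[w]].
    + exact: r_scan_start E.
    + rewrite mem_filter mem_words => /andP[wp /eqP sw] [-> -> -> ->].
      (* An empty [w] of the length of [p] would equal [p], so there is a first letter to pass. *)
      case: w => [|a w] in wp sw *; first by case: (p) wp sw.
      by rewrite /= take0; apply: r_scan E sw wp.
    case/flattenP => ws /mapP[j]; rewrite mem_iota => jp ->.
    by rewrite mem_words => /eqP sw [-> -> -> ->]; apply: r_scan_end E _; rewrite sw.
  - by rewrite inE => /eqP[-> -> -> ->]; apply: r_rewrite E.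
have inI i k t : t \in instr_rules i k -> t \in productions.
  move=> tI; rewrite !mem_cat; do 4! (apply/orP; right).
  by apply/flattenP; exists (instr_rules i k) => //; apply: map_f (i, k) _; rewrite mem_enum.
case=> {u1 c u2 v} [|||i|c a mc|c a mc|i k E|i k p s E|i k n x s E|i k p s E|i k p s a v E sv vp|i k p s v E sv].
- by rewrite mem_cat inE eqxx.
- by rewrite mem_cat !inE eqxx orbT.
- by rewrite mem_cat !inE eqxx !orbT.
- by rewrite !mem_cat; apply/orP; right; apply/orP; left; apply: map_f; rewrite mem_enum.
- rewrite !mem_cat; do 2! (apply/orP; right); apply/orP; left.
  by apply/mapP; exists (c, a) => //; rewrite mem_filter mc mem_enum.
- rewrite !mem_cat; do 3! (apply/orP; right); apply/orP; left.
  by apply/mapP; exists (c, a) => //; rewrite mem_filter mc mem_enum.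
- by apply: (inI i k); rewrite /instr_rules E mem_head.
- by apply: (inI i k); rewrite /instr_rules E mem_head.
- by apply: (inI i k); rewrite /instr_rules E mem_head.
- by apply: (inI i k); rewrite /instr_rules E mem_head.
- apply: (inI i k); rewrite /instr_rules E inE mem_cat; apply/orP; right; apply/orP; left.
  apply/mapP; exists (a :: v); last by rewrite /= take0.
  by rewrite mem_filter vp mem_words sv eqxx.
apply: (inI i k); rewrite /instr_rules E inE mem_cat; apply/orP; right; apply/orP; right.
apply/mapP; exists v => //; apply/flattenP; exists (words (size v)); last by rewrite mem_words.
by apply: map_f; rewrite mem_iota.
Qed.

Definition program_grammar : ps_grammar T :=
  @PSGrammar T (N + control)%type (inr c_start)
    [seq (t.1.1 ++ ctl t.1.2 :: t.2.1, t.2.2) | t <- productions].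

Local Notation step := (@ps_step T program_grammar).

Lemma ps_wf_program_grammar : ps_wf program_grammar.
Proof.
move=> uv; rewrite In_seq_map => -[[[u1 c] [u2 v]] _ ->].
by rewrite has_cat /= orbT.
Qed.

Lemma stepP x y : step x y <-> exists u1 c u2 v p q,
  [/\ rule u1 c u2 v, x = (p ++ u1) ++ ctl c :: u2 ++ q & y = p ++ v ++ q].
Proof.
split=> [[u [v [p [q []]]]]|[u1 [c [u2 [v [p [q [r -> ->]]]]]]]].
  rewrite In_seq_map => -[[[u1 c] [u2 w]] /productionsP r [-> ->]] [-> ->].
  by exists u1, c, u2, w, p, q; rewrite -!catA.
exists (u1 ++ ctl c :: u2), v, p, q; rewrite -!catA; split=> //.
rewrite In_seq_map; exists ((u1, c), (u2, v)) => //.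
exact/productionsP.
Qed.

(** * Configurations and the place where a production applies *)

Definition config (l : seq control) (x : seq V) (c : control) (y : seq V) : seq W :=
  map ctl l ++ map emb x ++ ctl c :: map emb y ++ [:: R].

Lemma emb_inj : injective emb.
Proof. by move=> [a|a] [b|b] //= [->]. Qed.

(** The end markers are encoded as controls too and must be excluded, so that a configuration has
    exactly one head and a production can only apply there. *)
Definition is_head (a : W) : bool :=
  if a is inr (inr c) then (c != c_left) && (c != c_right) else false.

Lemma emb_head x : ~~ has is_head (map emb x).
Proof. by elim: x => //= -[a|a] x. Qed.

Lemma rule_head u1 c u2 v : rule u1 c u2 v -> is_head (ctl c).
Proof. by case=> // {}c a; case: c => [//|[[|[|[|o]]] i]]. Qed.

Lemma head_split (P : pred W) a p q a' p' q' : ~~ has P p -> ~~ has P q -> P a' ->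
  p ++ a :: q = p' ++ a' :: q' -> [/\ p = p', a = a' & q = q'].
Proof.
elim: p p' => [|b p IH] [|b' p'] //=.
- by move=> _ _ _ [-> ->].
- by move=> _ + Pa [_ E]; rewrite E has_cat /= Pa orbT.
- by rewrite negb_or => /andP[nb _] _ Pa [E]; rewrite E Pa in nb.
by rewrite negb_or => /andP[_ np] nq Pa [-> /(IH _ np nq Pa)[-> -> ->]].
Qed.

Lemma config_step l x c y z : l \in [:: [::]; [:: c_left]] -> step (config l x c y) z ->
  exists u1 u2 v p q, [/\ rule u1 c u2 v, map ctl l ++ map emb x = p ++ u1,
    map emb y ++ [:: R] = u2 ++ q & z = p ++ v ++ q].
Proof.
move=> ll /stepP[u1 [c' [u2 [v [p [q [r + ->]]]]]]].
rewrite /config catA; case/(@head_split is_head).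
- rewrite has_cat negb_or emb_head andbT.
  by move: ll; rewrite !inE => /orP[]/eqP->.
- by rewrite has_cat negb_or emb_head.
- exact: rule_head r.
move=> E1 [c'E] E2; subst c'; by exists u1, u2, v, p, q.
Qed.

Lemma emb_prefix y w q : map emb y ++ [:: R] = map emb w ++ q ->
  exists2 y', y = w ++ y' & q = map emb y' ++ [:: R].
Proof.
elim: w y => [|a w IH] [|b y] //=.
- by move <-; exists [::].
- by move <-; exists (b :: y).
- by case: a.
by case=> /emb_inj-> /IH[y' -> ->]; exists y'.
Qed.

Lemma emb_whole y w q : map emb y ++ [:: R] = (map emb w ++ [:: R]) ++ q ->
  y = w /\ q = [::].
Proof.
rewrite -catA => /emb_prefix[y' ->]; case: y' => [|a y'] /=; last by case: a.
by rewrite cats0 => -[].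
Qed.

Lemma left_end x p : L :: map emb x = p ++ [:: L] -> x = [::] /\ p = [::].
Proof.
case/lastP: x => [|x a]; first by case: p => // b [|? ?].
by rewrite map_rcons -rcons_cons cats1 => /rcons_inj[_]; case: a.
Qed.

Lemma move_inv l x p a : l \in [:: [::]; [:: c_left]] ->
  map ctl l ++ map emb x = p ++ [:: emb a] ->
  exists2 x', x = rcons x' a & p = map ctl l ++ map emb x'.
Proof.
move=> ll; case/lastP: x => [|x b].
  rewrite cats0 cats1; move: ll; rewrite !inE => /orP[]/eqP->; first by case: p.
  by case: p => [[]|? [|? ?]] //; case: a.
rewrite map_rcons cats1 -rcons_cat => /rcons_inj[<- /emb_inj->].
by exists x.
Qed.

Lemma right_config l x c y p q a :
  map ctl l ++ map emb x = p ++ [::] -> map emb y ++ [:: R] = [:: emb a] ++ q ->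
  exists x' y', p ++ [:: emb a; ctl c] ++ q = config l x' c y' /\ x' ++ y' = x ++ y.
Proof.
rewrite cats0 => <- /(@emb_prefix y [:: a])[y' -> ->].
exists (rcons x a), y'; rewrite cat_rcons; split=> //.
by rewrite -cats1 /config map_cat -!catA.
Qed.

Lemma left_config l x c y p q a : l \in [:: [::]; [:: c_left]] ->
  map ctl l ++ map emb x = p ++ [:: emb a] -> map emb y ++ [:: R] = [::] ++ q ->
  exists x' y', p ++ [:: ctl c; emb a] ++ q = config l x' c y' /\ x' ++ y' = x ++ y.
Proof.
move=> ll /(move_inv ll)[x' -> ->] E2.
exists x', (a :: y); rewrite cat_rcons; split=> //.
by rewrite -(E2 : _ = q) /config -!catA.
Qed.

(** * Soundness of the simulation *)

Definition leads i (k : 'I_size_bound.+1) (x : seq V) : Prop :=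
  forall z, runs (drop k (prog i)) x z -> reach z.

(** While a program runs, [leads] speaks of its possible results, so the word on which it started
    need not be recorded. During a scan every occurrence of [p] starts at the control or to its
    right. *)
Inductive config_inv : seq W -> Prop :=
| ci_start : config_inv [:: ctl c_start]
| ci_idle x y of reach (x ++ y) : config_inv (config [:: c_left] x c_idle y)
| ci_exec i k x y of @leads i k (x ++ y) :
    config_inv (config [:: c_left] x (c_exec i k) y)
| ci_scan i k p s x y of drop (k : 'I_size_bound.+1) (prog i) = Absent p :: s &
      leads i k (x ++ y) & (forall u w, x ++ y = u ++ p ++ w -> size x <= size u) :
    config_inv (config [:: c_left] x (c_scan i k) y)
| ci_final x y of reach (x ++ y) : config_inv (config [::] x c_final y)
| ci_end x of reach x : config_inv (map emb x).

(** An instruction at [k] puts [k] below the length of its program, so [k.+1] stays in range and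
    [inord] does not fall back to its default. *)
Lemma drop_next i (k : 'I_size_bound.+1) a s : drop k (prog i) = a :: s ->
  drop (inord k.+1 : 'I_size_bound.+1) (prog i) = s.
Proof.
move=> E; rewrite inordK; first by rewrite -addn1 addnC -drop_drop E /= drop0.
rewrite ltnS; apply: leq_trans (leq_bigmax i).
by rewrite ltnNge; apply/negP => /drop_oversize; rewrite E.
Qed.

Lemma config_inv_step x y : config_inv x -> step x y -> config_inv y.
Proof.
have ll : [:: c_left] \in [:: [::]; [:: c_left]] by rewrite !inE eqxx orbT.
have l0 : [::] \in [:: [::]; [:: c_left]] by rewrite !inE eqxx.
case=> {x} [|x1 x2 rx|i k x1 x2 rx|i k p0 s0 x1 x2 Ek rx nf|x1 x2 rx|x rx].
- case/stepP=> u1 [c [u2 [v [p [q [r E ->]]]]]].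
  have [] := @head_split is_head (ctl c_start) [::] [::] _ _ _ isT isT (rule_head r) E.
  move=> /esym E1 [cE] /esym E2.
  case: p E1 {E} => // /= ?; subst u1; case: q E2; last by case: (u2).
  rewrite cats0 => ?; subst u2; rewrite cats0.
  inversion r; subst => //.
  by apply: (@ci_idle [::] [:: inr n0]); apply: rtc_refl.
- case/(config_step ll)=> u1 [u2 [v [p [q [r E1 E2 zE]]]]].
  inversion r; subst.
  + case/left_end: E1 => -> -> /= in rx *; rewrite -(E2 : _ = q).
    exact: (@ci_final [::]).
  + rewrite cats0 in E1; rewrite -E1 -(E2 : _ = q).
    apply: ci_exec => z; rewrite drop0 => H.
    by apply: rtc_snoc rx _; exists i.
  + have [x' [y' [-> xy]]] := right_config c_idle E1 E2.
    by apply: ci_idle; rewrite xy.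
  + have [x' [y' [-> xy]]] := left_config c_idle ll E1 E2.
    by apply: ci_idle; rewrite xy.
- case/(config_step ll)=> u1 [u2 [v [p [q [r E1 E2 zE]]]]].
  inversion r; subst; try match goal with H : drop _ _ = _ |- _ => rename H into Ek end.
  + have [x' [y' [-> xy]]] := right_config (c_exec i k) E1 E2.
    by apply: ci_exec; rewrite xy.
  + have [x' [y' [-> xy]]] := left_config (c_exec i k) ll E1 E2.
    by apply: ci_exec; rewrite xy.
  + rewrite cats0 in E1; rewrite -E1 -(E2 : _ = q).
    by apply: ci_idle; apply: rx; rewrite Ek.
  + rewrite cats0 in E1; rewrite -E1 cat_cons -E2.
    case/emb_prefix: E2 => y' yE qE.
    apply: ci_exec => z; rewrite (drop_next Ek) => H; apply: rx; rewrite Ek.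
    by exists (x1 ++ x2); split=> //; split=> //; exists x1, y'; rewrite yE.
  + rewrite cats0 in E1; rewrite -E1.
    case/(@emb_prefix x2 [:: inr n]): E2 => y' yE ->.
    have -> : ([seq ctl i | i <- [:: c_left]] ++ [seq emb i | i <- x1]) ++
      (ctl (c_next i k) :: [seq emb i | i <- x]) ++ [seq emb i | i <- y'] ++ [:: R]
      = config [:: c_left] x1 (c_next i k) (x ++ y') by rewrite /config map_cat -!catA.
    apply: ci_exec => z; rewrite (drop_next Ek) => H; apply: rx; rewrite Ek.
    by exists (x1 ++ x ++ y'); split=> //; exists x1, y'; rewrite yE.
  + case/left_end: E1 => -> -> /= in rx *; rewrite -(E2 : _ = q).
    by apply: (@ci_scan i k p0 s [::] x2).
- case/(config_step ll)=> u1 [u2 [v [p [q [r E1 E2 zE]]]]].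
  inversion r; subst => //.
  + rewrite cats0 in E1; rewrite -E1.
    case/emb_prefix: E2 => y' yE ->.
    have -> : ([seq ctl i | i <- [:: c_left]] ++ [seq emb i | i <- x1]) ++
      (emb a :: ctl (c_scan i k) :: [seq emb i | i <- v0]) ++ [seq emb i | i <- y'] ++ [:: R]
      = config [:: c_left] (rcons x1 a) (c_scan i k) (v0 ++ y').
      by rewrite /config map_rcons -cats1 map_cat -!catA.
    have xE : rcons x1 a ++ v0 ++ y' = x1 ++ x2 by rewrite cat_rcons yE.
    apply: (ci_scan Ek); rewrite xE // => u w E.
    have le_u : size x1 <= size u by apply: nf E.
    (* An occurrence starting at the old position would be the word just read, which differs from
       [p]. *)
    rewrite size_rcons ltn_neqAle le_u andbT; apply/eqP => szu.
    move/eqP: E; rewrite -xE cat_rcons eqseq_cat // => /andP[_].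
    match goal with H : is_true (_ != ?q), Hs : size _ = size ?q |- _ =>
      (have qE : q = p0 by congruence); rewrite qE in H Hs; move: Hs H => sv vp end.
    by rewrite -cat_cons eqseq_cat // (negPf vp).
  + rewrite cats0 in E1; rewrite -E1.
    case/emb_whole: E2 => x2E ->; rewrite cats0; subst x2.
    apply: ci_exec => z; rewrite (drop_next Ek) => H; apply: rx; rewrite Ek.
    (* An occurrence would start no earlier than [size x1], but fewer than [size p] letters
       follow. *)
    exists (x1 ++ v0); split=> //; split=> // -[u [w E]].
    have := congr1 size E; have := nf _ _ E; rewrite !size_cat.
    match goal with H : is_true (size _ < size ?q) |- _ =>
      (have qE : q = p0 by congruence); rewrite qE in H; move: H end.
    by lia.
- case/(config_step l0)=> u1 [u2 [v [p [q [r E1 E2 zE]]]]].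
  inversion r; subst.
  + rewrite cats0 in E1; rewrite -E1.
    case: (@emb_whole x2 [::] q E2) => x2E ->.
    by rewrite /= cats0; apply: (@ci_end x1); rewrite x2E cats0 in rx.
  + have [x' [y' [-> xy]]] := right_config c_final E1 E2.
    by apply: ci_final; rewrite xy.
  + have [x' [y' [-> xy]]] := left_config c_final l0 E1 E2.
    by apply: ci_final; rewrite xy.
- case/stepP=> u1 [c [u2 [v [p [q [r E _]]]]]].
  have := emb_head x; rewrite E has_cat negb_or => /andP[_].
  by rewrite -cat1s has_cat has_seq1 (rule_head r).
Qed.

(** * Completeness of the simulation *)

Lemma rule_step u1 c u2 v p q : rule u1 c u2 v ->
  step ((p ++ u1) ++ ctl c :: u2 ++ q) (p ++ v ++ q).
Proof. by move=> r; apply/stepP; exists u1, c, u2, v, p, q. Qed.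

Lemma rule_config u1 c u2 v l x y p q z : rule u1 c u2 v ->
  p ++ u1 = map ctl l ++ map emb x -> u2 ++ q = map emb y ++ [:: R] ->
  z = p ++ v ++ q -> step (config l x c y) z.
Proof.
move=> r E1 E2 ->; rewrite /config catA -E1 -E2; exact: rule_step.
Qed.

Lemma move_left_steps l x c y : movable c ->
  rtc step (config l x c y) (config l [::] c (x ++ y)).
Proof.
move=> mc; elim/last_ind: x y => [|x a IH] y; first exact: rtc_refl.
rewrite cat_rcons; apply: rtc_step (IH _).
apply: (rule_config (r_left a mc) (p := map ctl l ++ map emb x)) => //.
  by rewrite map_rcons cats1 -rcons_cat.
by rewrite /config -!catA.
Qed.

Lemma move_right_steps l x c y : movable c ->
  rtc step (config l [::] c (x ++ y)) (config l x c y).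
Proof.
move=> mc; elim/last_ind: x y => [|x a IH] y; first exact: rtc_refl.
rewrite cat_rcons; apply: rtc_snoc (IH _) _.
apply: (rule_config (r_right a mc) (p := map ctl l ++ map emb x) (q := map emb y ++ [:: R])) => //.
  by rewrite cats0.
by rewrite /config map_rcons -cats1 -!catA.
Qed.

Lemma move_steps l x c y x' y' : movable c -> x ++ y = x' ++ y' ->
  rtc step (config l x c y) (config l x' c y').
Proof.
move=> mc E; apply: rtc_trans (move_left_steps l x y mc) _.
by rewrite E; apply: move_right_steps.
Qed.

(** Induction on the unread part: since [p] is not a factor, either the next [size p] letters differ
    from it or fewer remain. For the same reason [p] is nonempty. *)
Lemma scan_steps i k p s x y : drop (k : 'I_size_bound.+1) (prog i) = Absent p :: s ->
  ~ is_factor p (x ++ y) -> exists x' y', x' ++ y' = x ++ y /\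
    rtc step (config [:: c_left] x (c_scan i k) y) (config [:: c_left] x' (c_next i k) y').
Proof.
move=> Ek; elim: y x => [|a y IH] x np.
  exists x, [::]; split=> //; apply: rtc_one.
  have p_gt0 : size (Nil V) < size p by case: (p) np => // -[]; exists x, [::].
  apply: (rule_config (r_scan_end Ek p_gt0) (p := map ctl [:: c_left] ++ map emb x) (q := [::])) => //.
    by rewrite cats0.
have [lt_p|le_p] := ltnP (size (a :: y)) (size p).
  exists x, (a :: y); split=> //; apply: rtc_one.
  apply: (rule_config (r_scan_end Ek lt_p) (p := map ctl [:: c_left] ++ map emb x) (q := [::])) => //.
  - by rewrite cats0.
  - by rewrite cats0.
  by rewrite /config -catA cats0.
have [|x' [y' [xy st]]] := IH (rcons x a); first by rewrite cat_rcons.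
rewrite cat_rcons in xy.
exists x', y'; split=> //; apply: rtc_step st.
have p_gt0 : 0 < size p by case: (p) np => // -[]; exists x, (a :: y).
pose v := take (size p).-1 y.
have sv : size (a :: v) = size p.
  by rewrite /= size_takel ?prednK // -ltnS prednK.
have vp : a :: v != p.
  apply/negP => /eqP vp; apply: np; exists x, (drop (size p).-1 y).
  by rewrite -{1}vp /= cat_take_drop.
apply: (rule_config (r_scan Ek sv vp) (p := map ctl [:: c_left] ++ map emb x)
  (q := map emb (drop (size p).-1 y) ++ [:: R])).
- by rewrite cats0.
- by rewrite catA -map_cat /= cat_take_drop.
rewrite /config map_rcons -cats1 -!catA; congr (_ ++ (_ ++ _)) => /=.
by rewrite catA -map_cat cat_take_drop.
Qed.

(** After each instruction the control walks back to the left end, where a scan has to begin. *)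
Lemma run_steps i (k : 'I_size_bound.+1) s x y : drop k (prog i) = s -> runs s x y ->
  rtc step (config [:: c_left] [::] (c_exec i k) x) (config [:: c_left] [::] c_idle y).
Proof.
elim: s k x => [|a s IH] k x Ek /=.
  move=> <-; apply: rtc_one.
  by apply: (rule_config (r_done Ek) (p := [:: L])).
case=> z []; have {}IH := IH _ z (drop_next Ek).
case: a Ek => [p|p|n t] Ek /=.
- case=> -[u [w xE]] zx /IH; rewrite {z IH}zx => st.
  apply: rtc_trans (_ : rtc step _ (config [:: c_left] u (c_exec i k) (p ++ w))) _.
    by apply: move_steps => //; rewrite xE.
  apply: rtc_step (_ : step _ (config [:: c_left] u (c_next i k) (p ++ w))) _.
    apply: (rule_config (r_present Ek) (p := map ctl [:: c_left] ++ map emb u)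
      (q := map emb w ++ [:: R])).
    + by rewrite cats0.
    + by rewrite map_cat -catA.
    by rewrite /config map_cat -!catA.
  apply: rtc_trans st; apply: move_steps => //; by rewrite xE.
- case=> np zx /IH; rewrite {z IH}zx => st.
  have [x' [y' [xy scan]]] := scan_steps (x := [::]) Ek np.
  apply: rtc_step (_ : step _ (config [:: c_left] [::] (c_scan i k) x)) _.
    by apply: (rule_config (r_scan_start Ek) (p := [::])).
  apply: rtc_trans scan _; apply: rtc_trans st.
  exact: move_steps.
case=> u [w [xE zE]] /IH st.
apply: rtc_trans (_ : rtc step _ (config [:: c_left] u (c_exec i k) (inr n :: w))) _.
  by apply: move_steps => //; rewrite xE.
apply: rtc_step (_ : step _ (config [:: c_left] u (c_next i k) (t ++ w))) _.
  apply: (rule_config (r_rewrite Ek) (p := map ctl [:: c_left] ++ map emb u)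
    (q := map emb w ++ [:: R])) => //.
  + by rewrite cats0.
  by rewrite /config map_cat -!catA.
apply: rtc_trans st; apply: move_steps => //; by rewrite zE.
Qed.

Lemma program_grammar_lang w : ps_lang program_grammar w <-> reach (map inl w).
Proof.
have embE : map emb (map inl w) = map inl w by rewrite -map_comp.
split=> [d|rw].
  have: config_inv (map inl w) by apply: rtc_invariant config_inv_step _ _ d ci_start.
  have noctl c q p : map inl w <> p ++ ctl c :: q.
    move=> E; have : ctl c \in map inl w by rewrite E mem_cat mem_head orbT.
    by case/mapP.
  move zE: (map inl w) => z Iz; case: Iz zE => {z}.
  - by move=> /(noctl _ _ [::]).
  - by move=> x y _; rewrite /config catA => /noctl.
  - by move=> i k x y _; rewrite /config catA => /noctl.
  - by move=> i k p s x y _ _ _; rewrite /config catA => /noctl.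
  - by move=> x y _; rewrite /config catA => /noctl.
  by move=> x rx; rewrite -embE => /(inj_map emb_inj) ->.
have idle : rtc step [:: ctl c_start] (config [:: c_left] [::] c_idle (map inl w)).
  apply: (rtc_invariant (I := fun x => rtc step [:: ctl c_start]
    (config [:: c_left] [::] c_idle x)) _ rw).
    move=> x y st [i ri]; apply: rtc_trans st _.
    apply: rtc_step (run_steps (k := ord0) _ ri); last by rewrite drop0.
    by apply: (rule_config (r_pick i) (p := [:: L])).
  by apply: rtc_one; apply: (rule_step [::] [::] r_start).
apply: rtc_trans idle _.
(* The control consumes the left marker, walks to the right one and vanishes together with it. *)
apply: rtc_step (_ : step _ (config [::] [::] c_final (map inl w))) _.
  by apply: (rule_config r_final (p := [::])).
apply: rtc_trans (_ : rtc step _ (config [::] (map inl w) c_final [::])) _.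
  by apply: move_steps; rewrite ?cats0.
apply: rtc_one; apply: (rule_config r_end (p := map inl w) (q := [::])) => //.
  by rewrite cats0 embE.
by rewrite /= cats0.
Qed.

End Programs.

(** * Equality of the two language classes *)

Lemma SCM_RE (T : finType) (L : seq T -> Prop) i j n m l s : SCM i j n m l s L -> RE L.
Proof.
case=> G [_ LG]; set progs := map (@matrix_program T (scm_N G)) (scm_M G).
exists (program_grammar (scm_S G) progs); split; first exact: ps_wf_program_grammar.
have In_progs p : In_seq p progs <-> exists r, In_seq r (scm_M G) /\ p = matrix_program r.
  rewrite /progs; elim: (scm_M G) => /= [|r rs IH]; first by split=> // -[? []].
  split=> [[<-|/(proj1 IH)[r' [? ->]]]|[r' [[<- ->|r'rs pE]]]].
  - by exists r; split=> //; left.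
  - by exists r'; split=> //; right.
  - by left.
  by right; apply: (proj2 IH); exists r'.
have stepE x y : @scm_step T G x y <-> prog_step progs x y.
  split=> [[r [rM /runs_matrix_program rxy]]|[k]].
    have /(proj1 (In_seq_tnth _ _))[k kE] : In_seq (matrix_program r) progs.
      by apply/In_progs; exists r.
    by exists k; rewrite -kE.
  have /In_progs[r [rM ->]] : In_seq (tnth (in_tuple progs) k) progs.
    by apply/In_seq_tnth; exists k.
  by move/runs_matrix_program => rxy; exists r.
move=> w; rewrite program_grammar_lang LG; split; apply: rtc_mono => x y.
  by move/stepE.
by move/(proj2 (stepE _ _)).
Qed.

Theorem mainTheorem8 (T : finType) (L : seq T -> Prop) :
  RE L <-> SCM 7 2 (Some 3) None (Some 2) (Some 3) L.
Proof.
split; last exact: SCM_RE.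
case=> G [_ LG]; exists (tiling_grammar (coded_tiles G) (code (G := G) None)).
split; first exact: scm_params_tiling_grammar.
by move=> w; rewrite tiling_grammar_lang -ps_lang_tiling.
Qed.
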